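(* If $f\in L^1(S^{4n-1})$, then for $\alpha>1$ and for almost all $\zeta\in S^{4n-1}$ (with respect to $\sigma$), $$\lim_{\substack{\mathbf{q}\to\zeta\\ \mathbf{q}\in A_\alpha(\zeta)}}P[f](\mathbf{q})=f(\zeta).$$
   Context: $\mathbb{H}^n$ is the space of quaternionic $(n\times1)$ column vectors ($n\ge1$), $\mathbf{a}^*=\bar{\mathbf{a}}^t$, $|\mathbf{q}|^2=\mathbf{q}^*\mathbf{q}$, $B^{4n}=\{\mathbf{q}\in\mathbb{H}^n:|\mathbf{q}|<1\}$, $S^{4n-1}=\partial B^{4n}$; $\sigma$ is the rotation-invariant measure on $S^{4n-1}$ with $\sigma(S^{4n-1})=1$, and $L^1(S^{4n-1})=L^1(S^{4n-1},\sigma)$. The $\mathcal{QM}$-Poisson integral is $P[f](\mathbf{q})=\int_{S^{4n-1}}P(\mathbf{q},\zeta)f(\zeta)\,d\sigma(\zeta)$, with $P(\mathbf{q},\zeta)=\left(\frac{1-|\mathbf{q}|^2}{|1-\mathbf{q}^*\zeta|^2}\right)^{2n+1}$ for $\mathbf{q}\in B^{4n}$, $\zeta\in S^{4n-1}$. The non-tangential approach region at $\zeta\in S^{4n-1}$ is $A_\alpha(\zeta)=\{\mathbf{q}\in B^{4n}:|\mathbf{q}-\zeta|<\alpha(1-|\mathbf{q}|)\}$. *)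

(* Defs.v *)
From HB Require Import structures.
From mathcomp Require Import all_boot all_order all_algebra.
From mathcomp Require Import all_classical all_reals all_analysis.
From mathcomp Require Import complex ring lra.

Set Implicit Arguments.
Unset Strict Implicit.
Unset Printing Implicit Defensive.

Import Order.TTheory GRing.Theory Num.Theory.
Import numFieldNormedType.Exports.

Local Open Scope classical_set_scope.
Local Open Scope ring_scope.

(* The skew field of quaternions a + b i + c j + d k, carried by R^4 and its
   product topology. *)
Definition quat (R : realType) : Type := 'rV[R]_4.

Section Quaternion.
Variable R : realType.

HB.instance Definition _ := GRing.Zmodule.copy (quat R) 'rV[R]_4.
HB.instance Definition _ := PointedTopological.copy (quat R) 'rV[R]_4.

Definition q0 (x : quat R) : R := (x : 'rV[R]_4) 0 (inord 0).
Definition q1 (x : quat R) : R := (x : 'rV[R]_4) 0 (inord 1).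
Definition q2 (x : quat R) : R := (x : 'rV[R]_4) 0 (inord 2).
Definition q3 (x : quat R) : R := (x : 'rV[R]_4) 0 (inord 3).

Definition mkquat (a b c d : R) : quat R :=
  (\row_(i < 4) [:: a; b; c; d]`_i : 'rV[R]_4).

Definition qone : quat R := mkquat 1 0 0 0.

Definition qmul (x y : quat R) : quat R := mkquat
  (q0 x * q0 y - q1 x * q1 y - q2 x * q2 y - q3 x * q3 y)
  (q0 x * q1 y + q1 x * q0 y + q2 x * q3 y - q3 x * q2 y)
  (q0 x * q2 y - q1 x * q3 y + q2 x * q0 y + q3 x * q1 y)
  (q0 x * q3 y + q1 x * q2 y - q2 x * q1 y + q3 x * q0 y).

Definition qconj (x : quat R) : quat R :=
  mkquat (q0 x) (- q1 x) (- q2 x) (- q3 x).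

Definition qreal (a : R) : quat R := mkquat a 0 0 0.

Lemma mkquat0 a b c d : q0 (mkquat a b c d) = a.
Proof. by rewrite /q0 mxE inordK. Qed.
Lemma mkquat1 a b c d : q1 (mkquat a b c d) = b.
Proof. by rewrite /q1 mxE inordK. Qed.
Lemma mkquat2 a b c d : q2 (mkquat a b c d) = c.
Proof. by rewrite /q2 mxE inordK. Qed.
Lemma mkquat3 a b c d : q3 (mkquat a b c d) = d.
Proof. by rewrite /q3 mxE inordK. Qed.
Definition mkquatE := (mkquat0, mkquat1, mkquat2, mkquat3).

Lemma quatP (x y : quat R) :
  [/\ q0 x = q0 y, q1 x = q1 y, q2 x = q2 y & q3 x = q3 y] -> x = y.
Proof.
case=> h0 h1 h2 h3; apply/rowP => i; rewrite -(inord_val i).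
by case: i => -[|[|[|[|//]]]].
Qed.

Lemma q0D (x y : quat R) : q0 (x + y) = q0 x + q0 y. Proof. exact: mxE. Qed.
Lemma q1D (x y : quat R) : q1 (x + y) = q1 x + q1 y. Proof. exact: mxE. Qed.
Lemma q2D (x y : quat R) : q2 (x + y) = q2 x + q2 y. Proof. exact: mxE. Qed.
Lemma q3D (x y : quat R) : q3 (x + y) = q3 x + q3 y. Proof. exact: mxE. Qed.
Definition qDE := (q0D, q1D, q2D, q3D).

Fact qmulA : associative qmul.
Proof. by move=> x y z; apply: quatP; rewrite /qmul !mkquatE; split; ring. Qed.
Fact qmul1l : left_id qone qmul.
Proof. by move=> x; apply: quatP; rewrite /qmul !mkquatE; split; ring. Qed.
Fact qmul1r : right_id qone qmul.
Proof. by move=> x; apply: quatP; rewrite /qmul !mkquatE; split; ring. Qed.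
Fact qmulDl : left_distributive qmul +%R.
Proof.
by move=> x y z; apply: quatP; rewrite !qDE /qmul !mkquatE !qDE; split; ring.
Qed.
Fact qmulDr : right_distributive qmul +%R.
Proof.
by move=> x y z; apply: quatP; rewrite !qDE /qmul !mkquatE !qDE; split; ring.
Qed.
Fact qone_neq0 : qone != 0.
Proof.
apply/eqP => /(congr1 q0); rewrite mkquat0 /q0 mxE => /eqP.
by rewrite oner_eq0.
Qed.

HB.instance Definition _ := GRing.Zmodule_isNzRing.Build (quat R)
  qmulA qmul1l qmul1r qmulDl qmulDr qone_neq0.

End Quaternion.

Section QuaternionicSpace.
Variable R : realType.

Definition hadj (n : nat) (a : 'cV[quat R]_n) : 'rV[quat R]_n :=
  map_mx (@qconj R) a^T.

(* a^* a is a real quaternion, see hadj_mul_self. *)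
Definition hnorm (n : nat) (a : 'cV[quat R]_n) : R :=
  Num.sqrt (q0 ((hadj a *m a) 0 0)).

Lemma hadj_mul_self (n : nat) (a : 'cV[quat R]_n) :
  (hadj a *m a) 0 0 =
  qreal (\sum_i (q0 (a i 0) ^+ 2 + q1 (a i 0) ^+ 2
                 + q2 (a i 0) ^+ 2 + q3 (a i 0) ^+ 2)).
Proof.
have -> : (hadj a *m a) 0 0 = \sum_i qmul (qconj (a i 0)) (a i 0).
  by rewrite mxE; apply: eq_bigr => i _; rewrite !mxE.
rewrite (eq_bigr (fun i => qreal (q0 (a i 0) ^+ 2 + q1 (a i 0) ^+ 2
    + q2 (a i 0) ^+ 2 + q3 (a i 0) ^+ 2))); last first.
  by move=> i _; apply: quatP; rewrite /qmul /qconj !mkquatE; split; ring.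
apply/esym/(big_morph (@qreal R)) => [x y|]; apply: quatP.
  by rewrite !qDE !mkquatE; split; ring.
by rewrite !mkquatE /q0 /q1 /q2 /q3 !mxE.
Qed.

Definition hball (n : nat) : set 'cV[quat R]_n := [set q | hnorm q < 1].
Definition hsphere (n : nat) : set 'cV[quat R]_n := [set q | hnorm q = 1].

Definition borelH (n : nat) := g_sigma_algebraType (@open 'cV[quat R]_n).

(* The orthogonal group O(4n) of H^n = R^(4n): the real-linear maps that
   preserve the norm. *)
Definition rotation (n : nat) (T : 'cV[quat R]_n -> 'cV[quat R]_n) : Prop :=
  (forall (a : R) p q, T (qreal a *: p + q) = qreal a *: T p + T q) /\
  (forall q, hnorm (T q) = hnorm q).

(* The measure of the unit sphere is represented by a Borel probability on H^n
   that is carried by the sphere. *)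
Definition rotation_invariant_on_sphere (n : nat)
    (sigma : probability (borelH n) R) : Prop :=
  sigma (@hsphere n) = 1%E /\
  (forall T : 'cV[quat R]_n -> 'cV[quat R]_n, rotation T ->
   forall A : set (borelH n), measurable A -> sigma (T @^-1` A) = sigma A).

Definition poisson_kernel (n : nat) (q zeta : 'cV[quat R]_n) : R :=
  ((1 - hnorm q ^+ 2) / hnorm (1%:M - hadj q *m zeta) ^+ 2) ^+ (2 * n).+1.

Definition L1_sphere (n : nat) (sigma : probability (borelH n) R)
    (f : 'cV[quat R]_n -> R[i]) : Prop :=
  sigma.-integrable (@hsphere n) (EFin \o (fun zeta => complex.Re (f zeta))) /\
  sigma.-integrable (@hsphere n) (EFin \o (fun zeta => complex.Im (f zeta))).

(* The kernel is real, so the integral of a complex-valued f is taken on real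
   and imaginary parts. *)
Definition poisson_integral (n : nat) (sigma : probability (borelH n) R)
    (f : 'cV[quat R]_n -> R[i]) (q : 'cV[quat R]_n) : R[i] :=
  Complex
   (Rintegral sigma (@hsphere n) (fun zeta => poisson_kernel q zeta * complex.Re (f zeta)))
   (Rintegral sigma (@hsphere n) (fun zeta => poisson_kernel q zeta * complex.Im (f zeta))).

Definition approach_region (n : nat) (alpha : R) (zeta : 'cV[quat R]_n) :
    set 'cV[quat R]_n :=
  [set q | hball q /\ hnorm (q - zeta) < alpha * (1 - hnorm q)].

End QuaternionicSpace.

(* Main.v *)
(* The kernel is controlled by the gauge rho(z, x) = |1 - z^* x|, a quasi-metric on
   the sphere S.  Let m = 2n + 1.

   The means M(r) = int P(r u, x) dsigma(x), |u| = 1, are constant in r, hence equal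
   to 1.  Indeed sigma is annihilated by the generators of the rotations; in terms of
   the components y_0, ..., y_3 of u^* x, W = |u^* x|^2 and D = 1 - 2 r y_0 + r^2 W, this
   yields int D^-(m+1) ((1 + r^2) y_0 - r (1 + W)) dsigma = 0, and the integrand is
   d/dr ((1 - r^2) / D)^m up to a factor depending on r only.

   On the gauge ball of radius t and centre z one has P((1 - t) z, .) >= (4 t)^-m, so
   that this ball has measure at most (4 t)^m.  A Vitali covering argument then gives
   the weak type (1,1) bound for the maximal function attached to t^-m int_(rho < t) |f|,
   which dominates P[|f|] on the approach region.  Hence the class of the functions for
   which the convergence holds almost everywhere is closed in L^1.  It contains the
   bounded continuous functions, hence the indicators of open sets, of Borel sets by
   Dynkin's lemma, and finally every integrable function. *)

Require Import Defs.
From mathcomp Require Import all_boot all_order all_algebra.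
From mathcomp Require Import all_classical all_reals all_analysis.
From mathcomp Require Import measurable_realfun complex ring lra.

Set Implicit Arguments.
Unset Strict Implicit.
Unset Printing Implicit Defensive.

Import Order.TTheory GRing.Theory Num.Theory.
Import numFieldNormedType.Exports.

Local Open Scope classical_set_scope.
Local Open Scope ring_scope.

(** * Quaternions and the gauge |1 - z^* x| *)

(** The measure is given by its invariance alone, without density or coordinates, so every
    quantitative fact about it has to come out of that invariance. The single fact extracted is that
    the kernel has mean 1; the size of the gauge balls follows from it.

    Differentiation under the integral is replaced by expansions B + t C + O(t^2), uniform on S, a
    class stable under sums, products, powers and inverses. They serve twice: for the rotations,
    with t the sine of the angle, and for the radius r.

    The field behind the mean value identity is D^-m ((1 + W) u - y_0 u p) with p = u^* x, tested in
    the four directions u, u i, u j, u k. Summing the four identities gives y_0 D^-m the coefficient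
    -(4 n + 2) = -2 m, which is where the exponent 2 n + 1 of the kernel enters.

    This exponent is also the homogeneous dimension of S for the gauge: a ball of radius t extends
    about sqrt t in 4 n - 4 directions and about t in the 3 remaining ones, so its volume is of
    order t^(2 n + 1). The maximum of the kernel at distance t from S is of order t^-m, and this
    balance makes the maximal function the right one. *)

Lemma ler_of_sqr (R : realDomainType) (x y : R) : 0 <= y -> x ^+ 2 <= y ^+ 2 -> x <= y.
Proof.
move=> y0 xy; rewrite leNgt; apply/negP => yx; move: xy.
rewrite leNgt ltr_pXn2r ?nnegrE // ?yx//.
exact: le_trans y0 (ltW yx).
Qed.

Lemma eq_of_sqr (R : realDomainType) (x y : R) : 0 <= x -> 0 <= y -> x ^+ 2 = y ^+ 2 -> x = y.
Proof. by move=> x0 y0 /eqP; rewrite eqrXn2// => /eqP. Qed.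

(** Since u v <= (u^2 + v^2) / 2 <= a + b. It absorbs the cross term of [gauge_triangle] and is the
    origin of the factor 2 there. *)
Lemma am_gm_bound (R : realFieldType) (u v w a b : R) :
  u ^+ 2 <= 2 * a -> v ^+ 2 <= 2 * b -> w <= u * v -> w + a + b <= 2 * (a + b).
Proof. by move=> ua vb wuv; have := sqr_ge0 (u - v); nra. Qed.

Section QuaternionNorm.
Variable R : realType.
Implicit Types (x y p : quat R).

Definition qnorm2 x : R := q0 x ^+ 2 + q1 x ^+ 2 + q2 x ^+ 2 + q3 x ^+ 2.

Definition qdot x y : R := q0 x * q0 y + q1 x * q1 y + q2 x * q2 y + q3 x * q3 y.

Lemma qnorm2_ge0 x : 0 <= qnorm2 x.
Proof. by rewrite !addr_ge0 ?sqr_ge0. Qed.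

Lemma qmulE x y : x * y = qmul x y. Proof. by []. Qed.

Lemma q0N x : q0 (- x) = - q0 x. Proof. exact: mxE. Qed.
Lemma q1N x : q1 (- x) = - q1 x. Proof. exact: mxE. Qed.
Lemma q2N x : q2 (- x) = - q2 x. Proof. exact: mxE. Qed.
Lemma q3N x : q3 (- x) = - q3 x. Proof. exact: mxE. Qed.
Definition qNE := (q0N, q1N, q2N, q3N).

Lemma q00 : q0 (0 : quat R) = 0. Proof. exact: mxE. Qed.
Lemma q10 : q1 (0 : quat R) = 0. Proof. exact: mxE. Qed.
Lemma q20 : q2 (0 : quat R) = 0. Proof. exact: mxE. Qed.
Lemma q30 : q3 (0 : quat R) = 0. Proof. exact: mxE. Qed.
Definition q0E := (q00, q10, q20, q30).

Lemma q0_sum I (r : seq I) (P : pred I) (F : I -> quat R) :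
  q0 (\sum_(i <- r | P i) F i) = \sum_(i <- r | P i) q0 (F i).
Proof. by apply: (big_morph _ (@q0D R)); exact: q00. Qed.
Lemma q1_sum I (r : seq I) (P : pred I) (F : I -> quat R) :
  q1 (\sum_(i <- r | P i) F i) = \sum_(i <- r | P i) q1 (F i).
Proof. by apply: (big_morph _ (@q1D R)); exact: q10. Qed.
Lemma q2_sum I (r : seq I) (P : pred I) (F : I -> quat R) :
  q2 (\sum_(i <- r | P i) F i) = \sum_(i <- r | P i) q2 (F i).
Proof. by apply: (big_morph _ (@q2D R)); exact: q20. Qed.
Lemma q3_sum I (r : seq I) (P : pred I) (F : I -> quat R) :
  q3 (\sum_(i <- r | P i) F i) = \sum_(i <- r | P i) q3 (F i).
Proof. by apply: (big_morph _ (@q3D R)); exact: q30. Qed.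
Definition q_sumE := (q0_sum, q1_sum, q2_sum, q3_sum).

Lemma q0_1 : q0 (1 : quat R) = 1. Proof. exact: mkquat0. Qed.
Lemma q1_1 : q1 (1 : quat R) = 0. Proof. exact: mkquat1. Qed.
Lemma q2_1 : q2 (1 : quat R) = 0. Proof. exact: mkquat2. Qed.
Lemma q3_1 : q3 (1 : quat R) = 0. Proof. exact: mkquat3. Qed.
Definition q1E := (q0_1, q1_1, q2_1, q3_1).

Definition qring := (qmulE, mkquatE, qDE, qNE, q0E, q1E).

Lemma qnorm2_mul x y : qnorm2 (x * y) = qnorm2 x * qnorm2 y.
Proof. by rewrite /qnorm2 qmulE /qmul !mkquatE; ring. Qed.

Lemma qconjB x y : qconj (x - y) = qconj x - qconj y.
Proof. by apply: quatP; rewrite /qconj !qring; split; ring. Qed.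

Lemma qdotE x : qdot x x = qnorm2 x. Proof. by rewrite /qdot/qnorm2; ring. Qed.

End QuaternionNorm.

Section HSpace.
Variables (R : realType) (n : nat).
Implicit Types (a b c q z : 'cV[quat R]_n).

Definition hdot a b : quat R := (hadj a *m b) 0 0.

Lemma hdotE a b : hdot a b = \sum_i qconj (a i 0) * b i 0.
Proof. by rewrite /hdot mxE; apply: eq_bigr => i _; rewrite !mxE. Qed.

Lemma hnorm_ge0 a : 0 <= hnorm a. Proof. exact: sqrtr_ge0. Qed.

Lemma hnorm_sqr a : hnorm a ^+ 2 = \sum_i qnorm2 (a i 0).
Proof.
rewrite /hnorm hadj_mul_self /qreal mkquat0 sqr_sqrtr //.
by apply: sumr_ge0 => i _; exact: qnorm2_ge0.
Qed.

Lemma hdotDr a b c : hdot a (b + c) = hdot a b + hdot a c.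
Proof. by rewrite /hdot mulmxDr mxE. Qed.

Lemma hdotNr a b : hdot a (- b) = - hdot a b.
Proof. by rewrite /hdot mulmxN mxE. Qed.

Lemma hadjB a b : hadj (a - b) = hadj a - hadj b.
Proof. by apply/matrixP => i j; rewrite !mxE qconjB. Qed.

Lemma hdotBl a b c : hdot (a - b) c = hdot a c - hdot b c.
Proof. by rewrite /hdot hadjB mulmxBl !mxE. Qed.

Lemma hdotBr a b c : hdot a (b - c) = hdot a b - hdot a c.
Proof. by rewrite hdotDr hdotNr. Qed.

Lemma hdot_self a : hdot a a = qreal (hnorm a ^+ 2).
Proof. by rewrite /hdot hadj_mul_self hnorm_sqr. Qed.

Lemma hdotC a b : hdot b a = qconj (hdot a b).
Proof.
rewrite !hdotE; apply: quatP; rewrite /qconj !mkquatE !q_sumE.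
by split; rewrite -?sumrN; apply: eq_bigr => i _; rewrite qmulE/qmul/qconj !mkquatE; ring.
Qed.

(** Cauchy-Schwarz: with s = |a|^2, t = |b|^2 and p = a^* b, the sum of the |s b_i - a_i p|^2 equals
    s (s t - |p|^2). The factor p stands on the right of a_i because the product does not commute.
    The case s = 0, where s cannot be cancelled, is separate. *)
Lemma qnorm2_hdot a b : qnorm2 (hdot a b) <= hnorm a ^+ 2 * hnorm b ^+ 2.
Proof.
set p := hdot a b; set s := hnorm a ^+ 2; set t := hnorm b ^+ 2.
have key : \sum_i (s ^+ 2 * qnorm2 (b i 0) -
     2 * s * qdot p (qconj (a i 0) * b i 0) + qnorm2 (a i 0) * qnorm2 p) =
   s ^+ 2 * t - 2 * s * qnorm2 p + s * qnorm2 p.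
  rewrite big_split /= -mulr_suml -hnorm_sqr -/s; congr (_ + _).
  rewrite sumrB -!mulr_sumr -hnorm_sqr -/t; congr (_ - _ * _).
  rewrite -qdotE {3}/p hdotE /qdot !q_sumE !mulr_sumr -!big_split /=.
  by apply: eq_bigr => i _.
have : 0 <= s * (s * t - qnorm2 p).
  have -> : s * (s * t - qnorm2 p) = s ^+ 2 * t - 2 * s * qnorm2 p + s * qnorm2 p by ring.
  rewrite -key; apply: sumr_ge0 => i _.
  have -> : s ^+ 2 * qnorm2 (b i 0) -
     2 * s * qdot p (qconj (a i 0) * b i 0) + qnorm2 (a i 0) * qnorm2 p =
     qnorm2 (qreal s * b i 0 - a i 0 * p).
    by rewrite /qnorm2 /qdot /qconj /qreal !qring; ring.
  exact: qnorm2_ge0.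
have [s0|s0] := eqVneq s 0.
  move=> _; rewrite s0 mul0r.
  have a0 i : qnorm2 (a i 0) = 0.
    apply/eqP; have := s0; rewrite /s hnorm_sqr => /eqP.
    rewrite psumr_eq0 => [/allP/(_ i)|j _]; last exact: qnorm2_ge0.
    by rewrite mem_index_enum; apply.
  suff -> : p = 0 by rewrite /qnorm2 !q0E !expr0n !addr0.
  rewrite /p hdotE big1// => i _.
  have : qnorm2 (qconj (a i 0) * b i 0) = 0.
    rewrite qnorm2_mul; suff -> : qnorm2 (qconj (a i 0)) = 0 by rewrite mul0r.
    by rewrite -(a0 i) /qnorm2 /qconj !mkquatE !sqrrN.
  move: (_ * _) => x; rewrite /qnorm2 => x0; apply: quatP; rewrite !q0E.
  by split; nra.
have s_gt0 : 0 < s by rewrite lt_def s0 sqr_ge0.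
by rewrite pmulr_rge0// subr_ge0.
Qed.

Lemma hnormN a : hnorm (- a) = hnorm a.
Proof.
rewrite /hnorm -!/(hdot _ _) hdotNr; congr (Num.sqrt (q0 _)).
by rewrite hdotC hdotNr !hdot_self /qconj; apply: quatP; rewrite !qring;
  split; ring.
Qed.

Lemma hnorm_subC a b : hnorm (a - b) = hnorm (b - a).
Proof. by rewrite -hnormN opprB. Qed.

Lemma hnormB_sqr a b :
  hnorm (a - b) ^+ 2 = hnorm a ^+ 2 + hnorm b ^+ 2 - 2 * q0 (hdot a b).
Proof.
have := congr1 (@q0 R) (hdot_self (a - b)).
rewrite hdotBl !hdotBr !hdot_self (hdotC a b) /qreal/qconj !qring => <-; ring.
Qed.

Lemma norm_q0_hdot a b : `|q0 (hdot a b)| <= hnorm a * hnorm b.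
Proof.
rewrite -ler_sqr ?nnegrE ?mulr_ge0 ?hnorm_ge0// exprMn real_normK ?num_real//.
apply: le_trans (qnorm2_hdot a b); rewrite /qnorm2 -!addrA lerDl.
by rewrite !addr_ge0 ?sqr_ge0.
Qed.

Lemma ler_hnormB a b : hnorm (a - b) <= hnorm a + hnorm b.
Proof.
apply: ler_of_sqr; first by rewrite addr_ge0 ?hnorm_ge0.
rewrite hnormB_sqr; have := norm_q0_hdot a b; rewrite ler_norml => /andP[]; nra.
Qed.

Lemma ler_hnormD a b : hnorm (a + b) <= hnorm a + hnorm b.
Proof. by have := ler_hnormB a (- b); rewrite opprK hnormN. Qed.

Lemma hnorm_dist a b c : hnorm (a - c) <= hnorm (a - b) + hnorm (b - c).
Proof. by have := ler_hnormD (a - b) (b - c); rewrite addrA subrK. Qed.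

Lemma hnorm0 : hnorm (0 : 'cV[quat R]_n) = 0.
Proof.
apply/eqP; rewrite -sqrf_eq0 hnorm_sqr big1// => i _; rewrite mxE /qnorm2 !q0E.
ring. Qed.

End HSpace.

Section KoranyiGauge.
Variables (R : realType) (n : nat).
Implicit Types (a b c q z x : 'cV[quat R]_n).

Definition gauge a b : R := hnorm (1%:M - hadj a *m b).

Lemma hnorm1_sqr (M : 'cV[quat R]_1) : hnorm M ^+ 2 = qnorm2 (M 0 0).
Proof. by rewrite hnorm_sqr big_ord1. Qed.

Lemma gauge_entry a b : (1%:M - hadj a *m b) 0 0 = 1 - hdot a b.
Proof. by rewrite mxE [X in _ + X]mxE mxE. Qed.

Lemma gauge_sqr a b : gauge a b ^+ 2 = qnorm2 (1 - hdot a b).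
Proof. by rewrite hnorm1_sqr gauge_entry. Qed.

Lemma gauge_ge0 a b : 0 <= gauge a b. Proof. exact: hnorm_ge0. Qed.

Lemma gaugeC a b : gauge a b = gauge b a.
Proof.
apply: eq_of_sqr (gauge_ge0 a b) (gauge_ge0 b a) _.
by rewrite !gauge_sqr (hdotC a b) /qnorm2 /qconj !qring; ring.
Qed.

Lemma hnorm_hadj_mul a b : hnorm (hadj a *m b) <= hnorm a * hnorm b.
Proof.
apply: ler_of_sqr; first by rewrite mulr_ge0 ?hnorm_ge0.
by rewrite hnorm1_sqr exprMn; exact: qnorm2_hdot.
Qed.

Lemma q0_le_hnorm (M : 'cV[quat R]_1) : q0 (M 0 0) <= hnorm M.
Proof.
apply: ler_of_sqr; first exact: hnorm_ge0.
by rewrite hnorm1_sqr /qnorm2 -!addrA lerDl !addr_ge0 ?sqr_ge0.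
Qed.

Lemma gauge_ge a b : 1 - hnorm a * hnorm b <= gauge a b.
Proof.
have := q0_le_hnorm (1%:M - hadj a *m b).
rewrite gauge_entry !qring; apply: le_trans.
by rewrite lerD2l lerN2; apply: le_trans (norm_q0_hdot a b); exact: ler_norm.
Qed.

(** In the closed ball |a - b|^2 <= 2 Re(1 - a^* b). The square on the left lets the product of two
    Euclidean distances be absorbed by a sum of two gauges. *)
Lemma hnormB_sqr_le a b : hnorm a <= 1 -> hnorm b <= 1 ->
  hnorm (a - b) ^+ 2 <= 2 * gauge a b.
Proof.
move=> a1 b1; rewrite hnormB_sqr.
have := q0_le_hnorm (1%:M - hadj a *m b).
rewrite gauge_entry !qring -/(hdot a b) -/(gauge a b).
have : hnorm a ^+ 2 <= 1 by rewrite expr_le1// hnorm_ge0.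
have : hnorm b ^+ 2 <= 1 by rewrite expr_le1// hnorm_ge0.
lra.
Qed.

(* [1 - z^* x = (z - q)^* (q - x) + (1 - z^* q) + (1 - q^* x) - (1 - |q|^2)] *)
Lemma gauge_triangle z q x : hnorm z = 1 -> hnorm q <= 1 -> hnorm x = 1 ->
  gauge z x <= 2 * (gauge z q + gauge q x) + (1 - hnorm q ^+ 2).
Proof.
move=> z1 q1 x1.
have q21 : hnorm q ^+ 2 <= 1 by rewrite expr_le1// hnorm_ge0.
have E : 1%:M - hadj z *m x = hadj (z - q) *m (q - x) + (1%:M - hadj z *m q)
    + (1%:M - hadj q *m x) + (qreal (hnorm q ^+ 2 - 1))%:M.
  apply/matrixP => i j; rewrite !ord1.
  have H (M N : 'cV[quat R]_1) : (M + N) 0 0 = M 0 0 + N 0 0 by rewrite mxE.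
  have HN (M : 'cV[quat R]_1) : (- M) 0 0 = - M 0 0 by rewrite mxE.
  rewrite !H !HN -!/(hdot _ _) hdotBl !hdotBr hdot_self !mxE eqxx !mulr1n.
  move: (hdot z q) (hdot q x) (hdot z x) (hnorm q ^+ 2) => a b c r.
  by apply: quatP; rewrite /qreal !qring; split; ring.
have nr : hnorm ((qreal (hnorm q ^+ 2 - 1))%:M : 'cV[quat R]_1) = 1 - hnorm q ^+ 2.
  apply: eq_of_sqr (hnorm_ge0 _) _ _; first by rewrite subr_ge0.
  by rewrite hnorm1_sqr mxE eqxx mulr1n /qnorm2 /qreal !mkquatE; ring.
rewrite {1}/gauge E.
apply: le_trans (ler_hnormD _ _) _; rewrite nr lerD2r.
apply: le_trans (ler_hnormD _ _) _; apply: le_trans (lerD (ler_hnormD _ _) (lexx _)) _.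
rewrite -/(gauge z q) -/(gauge q x).
have z1' : hnorm z <= 1 by rewrite z1.
have x1' : hnorm x <= 1 by rewrite x1.
exact: am_gm_bound (hnormB_sqr_le z1' q1) (hnormB_sqr_le q1 x1')
  (hnorm_hadj_mul (z - q) (q - x)).
Qed.

Lemma gauge_quasi_triangle z q x : hnorm z = 1 -> hnorm q = 1 -> hnorm x = 1 ->
  gauge z x <= 2 * (gauge z q + gauge q x).
Proof.
move=> z1 q1 x1; have := @gauge_triangle z q x z1 _ x1.
by rewrite q1 lexx expr1n subrr addr0; exact.
Qed.

Lemma gauge_sub a b c : gauge a b <= gauge a c + hnorm a * hnorm (c - b).
Proof.
apply: le_trans (lerD (lexx _) (hnorm_hadj_mul a (c - b))).
rewrite /gauge; have -> : 1%:M - hadj a *m b = (1%:M - hadj a *m c) + hadj a *m (c - b).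
  by rewrite mulmxBr addrA subrK.
exact: ler_hnormD.
Qed.

Lemma gauge_self a : hnorm a = 1 -> gauge a a = 0.
Proof.
move=> a1; apply/eqP; rewrite -sqrf_eq0 gauge_sqr hdot_self a1 expr1n.
by rewrite /qnorm2 /qreal !qring; apply/eqP; ring.
Qed.

Lemma poisson_kernelE q z : poisson_kernel q z =
  ((1 - hnorm q ^+ 2) / gauge q z ^+ 2) ^+ (2 * n).+1.
Proof. by []. Qed.

End KoranyiGauge.

(** * Real coordinates, topology and measurability *)

Section RealCoordinates.
Variables (R : realType) (n : nat).
Implicit Types (a b z : 'cV[quat R]_n) (k l : 'I_n * 'I_4).

Definition rc k a : R := (a k.1 0 : 'rV[R]_4) 0 k.2.

Definition of_rc (x : 'I_n * 'I_4 -> R) : 'cV[quat R]_n :=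
  \col_i (\row_j x (i, j) : 'rV[R]_4).

Lemma of_rcK x k : rc k (of_rc x) = x k.
Proof. by rewrite /rc /of_rc !mxE; case: k. Qed.

Lemma rcP a b : (forall k, rc k a = rc k b) -> a = b.
Proof.
move=> ab; apply/matrixP => i j; rewrite ord1; apply/rowP => c.
exact: ab (i, c).
Qed.

Lemma rcD k a b : rc k (a + b) = rc k a + rc k b.
Proof. by rewrite /rc mxE mxE. Qed.

Lemma rcN k a : rc k (- a) = - rc k a.
Proof. by rewrite /rc mxE mxE. Qed.

Lemma big_ord4 (F : 'I_4 -> R) :
  \sum_i F i = F (inord 0) + F (inord 1) + F (inord 2) + F (inord 3).
Proof.
rewrite !big_ord_recl big_ord0 addr0 !addrA.
by congr (F _ + F _ + F _ + F _); apply: val_inj; rewrite /= inordK.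
Qed.

Lemma qnorm2_sum (x : quat R) : qnorm2 x = \sum_j (x : 'rV[R]_4) 0 j ^+ 2.
Proof. by rewrite big_ord4. Qed.

Lemma hnorm_sqr_rc a : hnorm a ^+ 2 = \sum_k rc k a ^+ 2.
Proof.
rewrite hnorm_sqr -(pair_bigA _ (fun i j => rc (i, j) a ^+ 2)) /=.
by apply: eq_bigr => i _; rewrite qnorm2_sum.
Qed.

Lemma rc_scale k (r : R) a : rc k (qreal r *: a) = r * rc k a.
Proof.
case: k => i j; rewrite /rc /= mxE -(inord_val j); case: j => -[|[|[|[|//]]]] /= _;
rewrite -!/(q0 _) -!/(q1 _) -!/(q2 _) -!/(q3 _) /qreal !qring; ring.
Qed.

Lemma hnorm_scale r a : hnorm (qreal r *: a) = `|r| * hnorm a.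
Proof.
apply/eqP; rewrite -(eqrXn2 (ltn0Sn 1)) ?mulr_ge0 ?hnorm_ge0//.
rewrite exprMn !hnorm_sqr_rc real_normK ?num_real// mulr_sumr.
by under eq_bigr do rewrite rc_scale exprMn.
Qed.

Lemma scale_qreal (r s : R) a : qreal r *: (qreal s *: a) = qreal (r * s) *: a.
Proof. by apply: rcP => k; rewrite !rc_scale mulrA. Qed.

Lemma scale_qreal1 a : qreal (1 : R) *: a = a.
Proof. by apply: rcP => k; rewrite rc_scale mul1r. Qed.

Lemma scale_qrealB (r s : R) a : qreal r *: a - qreal s *: a = qreal (r - s) *: a.
Proof. by apply: rcP => k; rewrite rcD rcN !rc_scale mulrBl. Qed.

Lemma rc_le_hnorm k a : `|rc k a| <= hnorm a.
Proof.
apply: ler_of_sqr; first exact: hnorm_ge0.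
rewrite real_normK ?num_real// hnorm_sqr_rc (bigD1 k)//= lerDl.
by apply: sumr_ge0 => i _; exact: sqr_ge0.
Qed.

Lemma nbhs_hnorm z (A : set 'cV[quat R]_n) :
  nbhs z A <-> exists2 e : R, 0 < e & forall y, hnorm (y - z) < e -> A y.
Proof.
split.
  case=> P Pz PA.
  (* The sets containing a norm ball around z form a filter, so the finitely many entries and
     coordinates can be treated one at a time with [filter_forall]. *)
  pose F := filter_from [set e : R | 0 < e] (fun e => [set y | hnorm (y - z) < e]).
  have FF : Filter F.
    apply: filter_from_filter; first by exists 1; exact: ltr01.
    move=> e1 e2 e10 e20; exists (Num.min e1 e2); first by rewrite /= lt_min; apply/andP.
    by move=> y; rewrite /= lt_min => /andP.
  have FP i : F [set y | P i 0 (y i 0)].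
    have := Pz i 0 => -[Q Qz QP].
    suff : F [set y | forall j, Q 0 j ((y i 0 : 'rV[R]_4) 0 j)].
      by apply: filterS => y /= yQ; apply: QP => i' j; rewrite ord1.
    apply: (@filter_forall _ _
      (fun j => [set y : 'cV[quat R]_n | Q 0 j ((y i 0 : 'rV[R]_4) 0 j)]) F) => j.
    have /nbhs_ballP[e /= e0 eQ] := Qz 0 j.
    exists e => // y /= ye; apply: eQ; rewrite /ball/= distrC.
    apply: le_lt_trans ye; apply: le_trans (rc_le_hnorm (i, j) _).
    by rewrite rcD rcN.
  have : F [set y | forall i, P i 0 (y i 0)].
    by exact: (@filter_forall _ _ (fun i => [set y : 'cV[quat R]_n | P i 0 (y i 0)]) F).
  case=> e e0 eP; exists e => // y /eP yP; apply: PA => i j; rewrite ord1; exact: yP.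
case=> e e0 eA.
(* With N real coordinates, each off by at most d = e / (2 (N + 1)), the squared norm is at most N
   d^2 <= ((N + 1) d)^2 = (e / 2)^2. *)
pose d := e / (2 * (\sum_(k : 'I_n * 'I_4) 1 + 1)).
have s0 : 0 <= \sum_(k : 'I_n * 'I_4) (1:R) by exact: sumr_ge0.
have d0 : 0 < d by rewrite divr_gt0// mulr_gt0//; lra.
exists (fun i _ => [set q : 'rV[R]_4 | forall j, `|(z i 0 : 'rV[R]_4) 0 j - q 0 j| < d]).
  move=> i j; rewrite ord1.
  exists (fun i' j => ball ((z i 0 : 'rV[R]_4) 0 j) d).
    by move=> i' j'; rewrite (ord1 i'); exact: nbhsx_ballx.
  by move=> q qd j'; exact: qd.
move=> y yd; apply: eA.
have h k : `|rc k (y - z)| <= d.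
  by rewrite rcD rcN distrC; apply/ltW; have := yd k.1 0 k.2.
apply: (@le_lt_trans _ _ (e / 2)); last lra.
apply: ler_of_sqr; first lra.
rewrite hnorm_sqr_rc.
apply: (@le_trans _ _ (\sum_(k : 'I_n * 'I_4) d ^+ 2)).
  by apply: ler_sum => k _; rewrite -(real_normK (num_real _)) lerXn2r ?nnegrE// ltW.
rewrite -(mulr1 (d ^+ 2)) -mulr_sumr.
have -> : e / 2 = d * (\sum_(k : 'I_n * 'I_4) 1 + 1).
  rewrite /d; field; apply/eqP; lra.
rewrite [leRHS]exprMn; apply: ler_wpM2l; [exact: sqr_ge0|nra].
Qed.

End RealCoordinates.

Section Continuity.
Variables (R : realType) (n : nat).

Definition hcontinuous_at (g : 'cV[quat R]_n -> R) z :=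
  forall e, 0 < e -> exists2 d, 0 < d & forall y, hnorm (y - z) < d -> `|g y - g z| < e.

Lemma open_hnorm (A : set 'cV[quat R]_n) :
  open A <-> forall z, A z -> exists2 e, 0 < e & forall y, hnorm (y - z) < e -> A y.
Proof.
rewrite openE; split=> oA z Az; first exact/nbhs_hnorm/oA.
by apply/nbhs_hnorm/oA.
Qed.

Lemma borel_open (A : set (borelH R n)) : @open 'cV[quat R]_n A -> measurable A.
Proof. exact: sub_sigma_algebra. Qed.

Lemma hcontinuous_measurable (g : 'cV[quat R]_n -> R) :
  (forall z, hcontinuous_at g z) -> measurable_fun setT (g : borelH R n -> R).
Proof.
move=> cg.
apply: (measurability _ (RGenOpens.measurableE R)).
move=> _ [_ [a [b ->] <-]]; rewrite setTI; apply: borel_open.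
apply/open_hnorm => z /= zab.
have : nbhs (g z) `]a, b[%classic by apply: open_nbhs_nbhs; split => //; exact: interval_open.
move=> /nbhs_ballP[e /= e0 eab].
have [d d0 dg] := cg z e e0; exists d => // y yd; apply: eab.
by rewrite /ball/= distrC dg.
Qed.

Lemma isometry_measurable (T : 'cV[quat R]_n -> 'cV[quat R]_n) :
  (forall y z, hnorm (T y - T z) = hnorm (y - z)) ->
  measurable_fun setT (T : borelH R n -> borelH R n).
Proof.
move=> iT.
apply: (@measurability _ _ (borelH R n) (borelH R n) setT T (@open 'cV[quat R]_n)) => //.
move=> _ [A oA <-]; rewrite setTI; apply: borel_open.
apply/open_hnorm => z /= Az; move/open_hnorm : oA => /(_ _ Az)[e e0 eA].
by exists e; [exact: e0|move=> y ye; apply: eA; rewrite iT].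
Qed.

Lemma hlipschitz_continuous (g : 'cV[quat R]_n -> R) (L : R) : 0 <= L ->
  (forall y z, `|g y - g z| <= L * hnorm (y - z)) -> forall z, hcontinuous_at g z.
Proof.
move=> L0 gL z e e0; exists (e / (L + 1)); first by rewrite divr_gt0//; lra.
move=> y yd; apply: le_lt_trans (gL y z) _.
apply: (@le_lt_trans _ _ ((L + 1) * hnorm (y - z))).
  by apply: ler_wpM2r; [exact: hnorm_ge0|lra].
by rewrite mulrC -ltr_pdivlMr//; lra.
Qed.

Lemma measurable_rc k : measurable_fun setT (rc k : borelH R n -> R).
Proof.
apply: hcontinuous_measurable; apply: (@hlipschitz_continuous _ 1) => // y z.
by rewrite mul1r -rcN -rcD; exact: rc_le_hnorm.
Qed.

Lemma ler_dist_hnorm (y z : 'cV[quat R]_n) : `|hnorm y - hnorm z| <= hnorm (y - z).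
Proof.
rewrite ler_norml; apply/andP; split.
  by have := hnorm_dist z y 0; rewrite !subr0 hnorm_subC; lra.
by have := hnorm_dist y z 0; rewrite !subr0; lra.
Qed.

Lemma measurable_hnorm : measurable_fun setT (@hnorm R n : borelH R n -> R).
Proof.
apply: hcontinuous_measurable; apply: (@hlipschitz_continuous _ 1) => // y z.
by rewrite mul1r; exact: ler_dist_hnorm.
Qed.

Lemma measurable_hsphere : measurable (@hsphere R n : set (borelH R n)).
Proof.
have -> : @hsphere R n = setT `&` @hnorm R n @^-1` [set 1] by rewrite setTI.
exact: measurable_hnorm.
Qed.

Lemma measurable_gauge q : measurable_fun setT (gauge q : borelH R n -> R).
Proof.
apply: hcontinuous_measurable; apply: (@hlipschitz_continuous _ (hnorm q)).
  exact: hnorm_ge0.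
move=> y z; rewrite ler_norml lerNl opprB !lerBlDl (gauge_sub q z y)/=.
by rewrite hnorm_subC; exact: gauge_sub.
Qed.

End Continuity.

(** * First order expansions under the expectation *)

(** As 0^-1 = 0, inversion is total but discontinuous at 0; that point is split off and continuity
    used on the rest. *)
Lemma measurable_invr (R : realType) : measurable_fun setT (fun x : R => x^-1).
Proof.
have -> : [set: R] = [set 0] `|` ~` [set 0] by rewrite setUv.
apply/measurable_funU => //; first exact: measurableC.
split; first exact: measurable_fun_set1.
have -> : ~` [set 0 : R] = [set x | x != 0].
  by apply/seteqP; split=> x /= /eqP.
apply: open_continuous_measurable_fun; first exact: open_neq.
by move=> x; rewrite inE => x0; exact: inv_continuous.
Qed.

Section BoundedMeasurable.
Context d (T : measurableType d) (R : realType) (mu : probability T R) (S : set T).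
Hypotheses (mS : measurable S) (muS : mu S = 1%E).
Implicit Types (f g : T -> R).

(** Only S has to carry the bound: inverses such as 1 / D are controlled on the sphere but may blow
    up elsewhere. Measurability is global so that composition needs no side condition. *)
Definition bounded_meas f :=
  measurable_fun setT f /\ exists2 M, 0 <= M & forall x, S x -> `|f x| <= M.

Local Notation E f := (Rintegral mu S f).

Lemma bounded_meas_integrable f : bounded_meas f -> mu.-integrable S (EFin \o f).
Proof.
move=> [mf [M M0 fM]].
apply: (@le_integrable _ _ _ _ _ _ _ (EFin \o cst M)) => //.
- by apply/measurable_EFinP; exact: measurable_funTS.
- by move=> x Sx; rewrite /= lee_fin (ger0_norm M0) fM.
- exact: finite_measure_integrable_cst.
Qed.

Lemma bounded_meas_cst c : bounded_meas (cst c).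
Proof. by split => //; exists `|c|. Qed.

Lemma bounded_measD f g : bounded_meas f -> bounded_meas g ->
  bounded_meas (fun x => f x + g x).
Proof.
move=> [mf [M M0 fM]] [mg [N N0 gN]]; split; first exact: measurable_funD.
exists (M + N) => [|x Sx]; first exact: addr_ge0.
by apply: le_trans (ler_normD _ _) _; rewrite lerD ?fM ?gN.
Qed.

Lemma bounded_measM f g : bounded_meas f -> bounded_meas g ->
  bounded_meas (fun x => f x * g x).
Proof.
move=> [mf [M M0 fM]] [mg [N N0 gN]]; split; first exact: measurable_funM.
exists (M * N) => [|x Sx]; first exact: mulr_ge0.
by rewrite normrM ler_pM ?fM ?gN.
Qed.

Lemma bounded_measX f k : bounded_meas f -> bounded_meas (fun x => f x ^+ k).
Proof.
move=> [mf [M M0 fM]]; split; first exact: measurable_funX.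
exists (M ^+ k) => [|x Sx]; first exact: exprn_ge0.
by rewrite normrX lerXn2r ?nnegrE ?fM.
Qed.

Lemma bounded_measV f c : 0 < c -> (forall x, S x -> c <= f x) ->
  measurable_fun setT f -> bounded_meas (fun x => (f x)^-1).
Proof.
move=> c0 cf mf; split; first exact: measurableT_comp (@measurable_invr R) mf.
exists c^-1 => [|x Sx]; first by rewrite invr_ge0 ltW.
have fc := cf x Sx.
by rewrite normfV ler_pV2 ?inE ?unitfE ?normr_gt0 ?normr_eq0 ?gt_eqF ?ger0_norm//;
  rewrite ?(lt_le_trans c0 fc)// ltW// (lt_le_trans c0 fc).
Qed.

Lemma bounded_meas_sum (I : Type) (r : seq I) (P : pred I) (f : I -> T -> R) :
  (forall i, P i -> bounded_meas (f i)) ->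
  bounded_meas (fun x => \sum_(i <- r | P i) f i x).
Proof.
move=> bf; elim: r => [|i r IH].
  rewrite (_ : (fun x => \sum_(j <- [::] | P j) f j x) = cst 0); first exact: bounded_meas_cst.
  by apply: funext => x; rewrite big_nil.
rewrite (_ : (fun x => \sum_(j <- i :: r | P j) f j x) =
  fun x => if P i then f i x + \sum_(j <- r | P j) f j x
  else \sum_(j <- r | P j) f j x); last by apply: funext => x; rewrite big_cons.
by case Pi : (P i) => //; apply: bounded_measD => //; exact: bf.
Qed.

Lemma expect_cst c : E (cst c) = c.
Proof.
have -> : E (cst c) = c * fine (mu S) by exact: Rintegral_cst.
by rewrite muS mulr1.
Qed.

Lemma expectD f g : bounded_meas f -> bounded_meas g ->
  E (fun x => f x + g x) = E f + E g.
Proof. by move=> bf bg; rewrite RintegralD//; exact: bounded_meas_integrable. Qed.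

Lemma expectZ c f : bounded_meas f -> E (fun x => c * f x) = c * E f.
Proof. by move=> bf; rewrite RintegralZl//; exact: bounded_meas_integrable. Qed.

Lemma expect_sum (I : Type) (r : seq I) (P : pred I) (f : I -> T -> R) :
  (forall i, P i -> bounded_meas (f i)) ->
  E (fun x => \sum_(i <- r | P i) f i x) = \sum_(i <- r | P i) E (f i).
Proof.
move=> bf; elim: r => [|i r IH].
  rewrite (_ : (fun x => \sum_(j <- [::] | P j) f j x) = cst 0).
    by rewrite big_nil expect_cst.
  by apply: funext => x; rewrite big_nil.
rewrite big_cons (_ : (fun x => \sum_(j <- i :: r | P j) f j x) =
  fun x => if P i then f i x + \sum_(j <- r | P j) f j x
  else \sum_(j <- r | P j) f j x); last by apply: funext => x; rewrite big_cons.
case Pi : (P i) => //; rewrite expectD ?IH//; first exact: bf.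
exact: bounded_meas_sum.
Qed.

Lemma eq_expect f g : (forall x, S x -> f x = g x) -> E f = E g.
Proof. by move=> fg; apply: eq_Rintegral => x /set_mem; exact: fg. Qed.

Lemma expect_le f M : bounded_meas f -> (forall x, S x -> `|f x| <= M) -> `|E f| <= M.
Proof.
move=> bf fM; have h := bounded_meas_integrable bf.
have hM : mu.-integrable S (EFin \o cst M) by exact: finite_measure_integrable_cst.
have hN : mu.-integrable S (EFin \o cst (- M)) by exact: finite_measure_integrable_cst.
rewrite ler_norml -{1}(expect_cst (- M)) -{2}(expect_cst M).
by apply/andP; split; apply: le_Rintegral => // x /fM; rewrite ler_norml => /andP[].
Qed.

(** Counterpart of [expect_sum] for summands that are not bounded, as happens in the maximal
    estimate. *)
Lemma Rintegral_sum_integrable (I : Type) (r : seq I) (g : I -> T -> R) :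
  (forall i, mu.-integrable S (EFin \o g i)) ->
  mu.-integrable S (EFin \o (fun x => \sum_(i <- r) g i x)) /\
  E (fun x => \sum_(i <- r) g i x) = \sum_(i <- r) E (g i).
Proof.
move=> intg; elim: r => [|i r [IHi IHe]].
  have -> : (fun x => \sum_(j <- [::]) g j x) = cst 0.
    by apply: funext => x; rewrite big_nil.
  rewrite big_nil expect_cst; split => //; exact: finite_measure_integrable_cst.
have -> : (fun x => \sum_(j <- i :: r) g j x) = (fun x => g i x + \sum_(j <- r) g j x).
  by apply: funext => x; rewrite big_cons.
split; last by rewrite RintegralD// big_cons IHe.
exact: (integrableD mS (intg i) IHi).
Qed.

(** A t = B + t C + O(t^2), uniformly on S. The explicit quadratic remainder passes through the
    integral by a mere bound, so that no interchange of limits is needed. *)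
Definition expands (A : R -> T -> R) (B C : T -> R) :=
  [/\ bounded_meas B, bounded_meas C &
   exists2 e, 0 < e & exists2 K, 0 <= K & forall t, `|t| < e ->
   bounded_meas (A t) /\ forall x, S x -> `|A t x - (B x + t * C x)| <= K * t ^+ 2].

Lemma expands_cst B : bounded_meas B -> expands (fun=> B) B (cst 0).
Proof.
move=> bB; split => //; first exact: bounded_meas_cst.
exists 1 => //; exists 0 => // t _; split => // x _.
by rewrite mulr0 addr0 subrr normr0 mul0r.
Qed.

Lemma expandsD A B C A' B' C' : expands A B C -> expands A' B' C' ->
  expands (fun t x => A t x + A' t x) (fun x => B x + B' x) (fun x => C x + C' x).
Proof.
move=> [bB bC [e e0 [K K0 AK]]] [bB' bC' [e' e'0 [K' K'0 AK']]].
split; [exact: bounded_measD..|].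
exists (Num.min e e'); first by rewrite lt_min e0.
exists (K + K') => [|t]; first exact: addr_ge0.
rewrite lt_min => /andP[te te'].
have [bA {}AK] := AK t te; have [bA' {}AK'] := AK' t te'.
split; first exact: bounded_measD.
move=> x Sx; rewrite mulrDl; apply: le_trans (lerD (AK x Sx) (AK' x Sx)).
apply: le_trans (ler_normD _ _); rewrite le_eqVlt; apply/orP; left; apply/eqP.
by congr `|_|; ring.
Qed.

Lemma expandsM A B C A' B' C' : expands A B C -> expands A' B' C' ->
  expands (fun t x => A t x * A' t x) (fun x => B x * B' x)
          (fun x => B x * C' x + C x * B' x).
Proof.
move=> [bB bC [e e0 [K K0 AK]]] [bB' bC' [e' e'0 [K' K'0 AK']]].
split; [exact: bounded_measM|by apply: bounded_measD; exact: bounded_measM|].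
have [_ [b b0 Bb]] := bB; have [_ [c c0 Cc]] := bC.
have [_ [b' b'0 Bb']] := bB'; have [_ [c' c'0 Cc']] := bC'.
(* Keeping |t| below 1 bounds t C, t C' and the remainder of A' by constants, so that every product
   of error terms is still a multiple of t^2. *)
exists (Num.min 1 (Num.min e e')); first by rewrite !lt_min ltr01 e0.
exists (K * (b' + c' + K') + (b + c) * K' + c * c') => [|t].
  by rewrite !(addr_ge0, mulr_ge0).
rewrite !lt_min => /and3P[t1 te te'].
have [bA {}AK] := AK t te; have [bA' {}AK'] := AK' t te'.
split; first exact: bounded_measM.
move=> x Sx.
have := AK x Sx; have := AK' x Sx.
have := Bb x Sx; have := Bb' x Sx; have := Cc x Sx; have := Cc' x Sx.
move: (A t x) (A' t x) (B x) (B' x) (C x) (C' x) => a a' p p' q q' qc' qc pb' pb r' r.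
set u := a - (p + t * q); set v := a' - (p' + t * q').
have -> : a * a' - (p * p' + t * (p * q' + q * p')) =
   u * (p' + t * q' + v) + (p + t * q) * v + t ^+ 2 * (q * q').
  by rewrite /u /v; ring.
have t2 : t ^+ 2 <= 1 by rewrite -(real_normK (num_real t)) expr_le1 ?normr_ge0 ?ltW.
have N (x1 y1 M M' : R) : `|x1| <= M -> `|y1| <= M' -> `|x1 * y1| <= M * M'.
  by move=> ? ?; rewrite normrM ler_pM.
have D (x1 y1 M M' : R) : `|x1| <= M -> `|y1| <= M' -> `|x1 + y1| <= M + M'.
  by move=> ? ?; apply: le_trans (ler_normD _ _) _; exact: lerD.
have tq : `|t * q| <= c by rewrite -(mul1r c); apply: N => //; exact: ltW.
have tq' : `|t * q'| <= c' by rewrite -(mul1r c'); apply: N => //; exact: ltW.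
have vK : `|v| <= K' by apply: le_trans r' _; rewrite ler_piMr.
have t2n : `|t ^+ 2| <= t ^+ 2 by rewrite ger0_norm ?sqr_ge0.
have -> : (K * (b' + c' + K') + (b + c) * K' + c * c') * t ^+ 2 =
  K * t ^+ 2 * (b' + c' + K') + (b + c) * (K' * t ^+ 2) + t ^+ 2 * (c * c') by ring.
apply: (D _ _ _ _); [apply: (D _ _ _ _)|].
- by apply: (N _ _ _ _) => //; apply: (D _ _ _ _) => //; exact: (D _ _ _ _).
- by apply: (N _ _ _ _) => //; exact: (D _ _ _ _).
- by apply: (N _ _ _ _) => //; exact: (N _ _ _ _).
Qed.

Lemma expandsV A B C c : expands A B C -> 0 < c ->
  (exists2 e, 0 < e & forall t x, `|t| < e -> S x -> c <= A t x) ->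
  expands (fun t x => (A t x)^-1) (fun x => (B x)^-1) (fun x => - C x / B x ^+ 2).
Proof.
move=> [bB bC [e e0 [K K0 AK]]] c0 [e' e'0 cA].
(* At t = 0 the remainder vanishes, so A 0 = B on S and B inherits the lower bound of A. *)
have cB x : S x -> c <= B x.
  have n0 (r : R) : 0 < r -> `|0 : R| < r by rewrite normr0.
  move=> Sx; have := cA 0 x (n0 _ e'0) Sx; have [_ /(_ x Sx)] := AK 0 (n0 _ e0).
  rewrite mul0r addr0 expr0n mulr0 normr_le0 subr_eq0 => /eqP -> //.
have bV : bounded_meas (fun x => (B x)^-1) by case: bB => mB _; exact: (bounded_measV c0).
split => //.
  apply: bounded_measM; last first.
    by under eq_fun do rewrite -exprVn; exact: bounded_measX.
  by under eq_fun do rewrite -mulN1r; apply: bounded_measM => //; exact: bounded_meas_cst.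
have [_ [b b0 Bb]] := bB; have [_ [q q0 Cq]] := bC.
exists (Num.min 1 (Num.min e e')); first by rewrite !lt_min ltr01 e0.
exists ((q ^+ 2 + K * (q + b)) / c ^+ 3) => [|t].
  by rewrite divr_ge0// ?exprn_ge0 ?addr_ge0 ?mulr_ge0 ?addr_ge0 ?sqr_ge0// ltW.
rewrite !lt_min => /and3P[t1 te te'].
have [bA {}AK] := AK t te.
split; first by case: bA => mA _; apply: (bounded_measV c0) => // x; exact: cA.
move=> x Sx.
have := AK x Sx; have := cB x Sx; have := cA t x te' Sx; have := Bb x Sx; have := Cq x Sx.
move: (A t x) (B x) (C x) => a p r rq pb ca cp.
set u := a - (p + t * r) => uK.
have a0 : 0 < a by exact: lt_le_trans ca.
have p0 : 0 < p by exact: lt_le_trans cp.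
(* Exact form of the remainder for a = p + t r + u: the terms of first order in t cancel, and u is
   already O(t^2). *)
have -> : a^-1 - (p^-1 + t * (- r / p ^+ 2)) =
    (t ^+ 2 * r ^+ 2 + u * (t * r - p)) / (a * p ^+ 2).
  by rewrite /u; field; apply/andP; split; apply/eqP; lra.
rewrite normrM normfV (ger0_norm (_ : 0 <= a * p ^+ 2)); last first.
  by rewrite mulr_ge0 ?sqr_ge0// ltW.
have -> : (q ^+ 2 + K * (q + b)) / c ^+ 3 * t ^+ 2 =
  ((q ^+ 2 + K * (q + b)) * t ^+ 2) / c ^+ 3 by rewrite mulrAC.
apply: ler_pM => //; first by rewrite invr_ge0 mulr_ge0 ?sqr_ge0// ltW.
  apply: le_trans (ler_normD _ _) _.
  rewrite [leRHS]mulrDl; apply: lerD.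
    rewrite -exprMn ger0_norm ?sqr_ge0// exprMn mulrC ler_wpM2r ?sqr_ge0//.
    by rewrite -(real_normK (num_real r)) lerXn2r ?nnegrE.
  rewrite normrM [leRHS]mulrAC ler_pM//.
  apply: le_trans (ler_normB _ _) _; apply: lerD => //.
  by rewrite normrM -(mul1r q) ler_pM// ltW.
rewrite lef_pV2 ?posrE ?exprn_gt0 ?mulr_gt0 ?exprn_gt0//.
rewrite exprS; apply: ler_pM => //; [exact: ltW|by rewrite exprn_ge0// ltW|].
by rewrite lerXn2r ?nnegrE ?(ltW c0) ?(ltW p0).
Qed.

Lemma expandsX A B C k : expands A B C ->
  expands (fun t x => A t x ^+ k) (fun x => B x ^+ k)
          (fun x => k%:R * B x ^+ k.-1 * C x).
Proof.
move=> h; elim: k => [|k IH].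
  suff -> : (fun x => 0%:R * B x ^+ 0.-1 * C x) = cst 0.
    exact: expands_cst (bounded_meas_cst 1).
  by apply: funext => x; rewrite !mul0r.
have := expandsM h IH.
suff -> : (fun x => B x * (k%:R * B x ^+ k.-1 * C x) + C x * B x ^+ k) =
   (fun x => k.+1%:R * B x ^+ k.+1.-1 * C x).
  by under eq_fun do under eq_fun do rewrite -exprS;
     under [in X in expands _ X]eq_fun do rewrite -exprS.
apply: funext => x /=; case: k {IH} => [|k]; first by rewrite /= !expr0; ring.
by rewrite /= exprS -[k.+2%:R]natr1; ring.
Qed.

Lemma expands_ext A B C A' B' C' :
  (forall t x, A t x = A' t x) -> (forall x, B x = B' x) -> (forall x, C x = C' x) ->
  expands A B C -> expands A' B' C'.
Proof.
move=> AA BB CC; suff [-> -> ->] : [/\ A = A', B = B' & C = C'] by [].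
by split; do ?[apply: funext => ?] => //; apply: funext.
Qed.

Lemma expect_expands A B C : expands A B C ->
  exists2 e, 0 < e & exists2 K, 0 <= K & forall t, `|t| < e ->
    `|E (A t) - (E B + t * E C)| <= K * t ^+ 2.
Proof.
move=> [bB bC [e e0 [K K0 AK]]]; exists e => //; exists K => // t te.
have [bA {}AK] := AK t te.
have bt : bounded_meas (fun x => t * C x).
  by apply: bounded_measM => //; exact: bounded_meas_cst.
have b1 : bounded_meas (fun x => -1 * (B x + t * C x)).
  by apply: bounded_measM; [exact: bounded_meas_cst|exact: bounded_measD].
have -> : E (A t) - (E B + t * E C) = E (fun x => A t x + -1 * (B x + t * C x)).
  rewrite expectD// expectZ; last exact: bounded_measD.
  by rewrite expectD// expectZ//; ring.
apply: expect_le; first exact: bounded_measD.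
by move=> x Sx; rewrite mulN1r; exact: AK.
Qed.

(** If the mean does not depend on t, then |t E C| <= K t^2, and dividing by a small t gives E C =
    0. This turns invariance under a family of rotations into an integral identity. *)
Lemma expect_expands_cst A B C : expands A B C ->
  (exists2 e, 0 < e & forall t, `|t| < e -> E (A t) = E B) -> E C = 0.
Proof.
move=> /expect_expands[e e0 [K K0 AK]] [e' e'0 AB].
apply/eqP; rewrite -normr_le0; apply/ler_addgt0Pr => r r0; rewrite add0r.
(* The halves keep |t| strictly inside both ranges, and K + 1 replaces K because K may be 0. *)
pose t := Num.min (e / 2) (Num.min (e' / 2) (r / (K + 1))).
have K1 : 0 < K + 1 by lra.
have t0 : 0 < t by rewrite !lt_min !divr_gt0.
have te : t <= e / 2 by rewrite ge_min lexx.
have te' : t <= e' / 2 by rewrite !ge_min lexx orbT.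
have tr : t <= r / (K + 1) by rewrite !ge_min lexx !orbT.
have tn : `|t| = t by rewrite ger0_norm// ltW.
have := AK t; rewrite AB tn; last lra.
move=> /(_ _); rewrite opprD addNKr normrN normrM tn expr2 => h.
have : t * `|E C| <= K * (t * t) by apply: h; lra.
rewrite mulrCA ler_pM2l// => /le_trans; apply.
move: tr; rewrite ler_pdivlMr//; nra.
Qed.

End BoundedMeasurable.

(** * Integration by parts for the rotation invariant measure *)

Section PlaneRotation.
Variables (R : realType) (n : nat).
Implicit Types (a b z : 'cV[quat R]_n) (k l : 'I_n * 'I_4).

(* [t] is the sine of the angle. *)
Definition plane_rot k l (t : R) a : 'cV[quat R]_n :=
  of_rc (fun j => if j == k then Num.sqrt (1 - t ^+ 2) * rc k a - t * rc l a
    else if j == l then t * rc k a + Num.sqrt (1 - t ^+ 2) * rc l a else rc j a).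

Lemma rotation_plane_rot k l t : k != l -> `|t| <= 1 -> rotation (plane_rot k l t).
Proof.
move=> kl t1; split.
  move=> r p q; apply: rcP => j; rewrite rcD rc_scale !of_rcK !rcD !rc_scale.
  by case: ifP => _; [ring|case: ifP => _; [ring|]].
have t2 : 0 <= 1 - t ^+ 2.
  by rewrite subr_ge0 -(real_normK (num_real t)) expr_le1.
move=> a; apply/eqP; rewrite -(eqrXn2 (ltn0Sn 1)) ?hnorm_ge0// !hnorm_sqr_rc.
apply/eqP; rewrite (bigD1 k)//= (bigD1 l) 1?eq_sym//=.
rewrite [RHS](bigD1 k)//= [in RHS](bigD1 l) 1?eq_sym//=.
rewrite !of_rcK eqxx eq_sym (negbTE kl) eqxx !addrA; congr (_ + _).
  by rewrite sqrrB sqrrD !exprMn sqr_sqrtr//; ring.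
by apply: eq_bigr => j /andP[jk jl]; rewrite of_rcK (negbTE jk) (negbTE jl).
Qed.

Lemma rotation_sub (T : 'cV[quat R]_n -> 'cV[quat R]_n) y z : rotation T ->
  hnorm (T y - T z) = hnorm (y - z).
Proof.
case=> lT nT; rewrite -(nT (y - z)).
have h1 (x : quat R) : qreal (-1) * x = - x.
  by apply: quatP; rewrite /qreal !qring; split; ring.
have h2 (x : 'cV[quat R]_n) : qreal (-1) *: x = - x.
  by apply/matrixP => i j; rewrite !mxE h1.
by have := lT (-1) z y; rewrite !h2 addrC => ->; rewrite addrC.
Qed.

End PlaneRotation.

Section Invariance.
Variables (R : realType) (n : nat) (sigma : probability (borelH R n) R).
Hypothesis sigma_inv : rotation_invariant_on_sphere sigma.
Local Notation S := (@hsphere R n : set (borelH R n)).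
Local Notation E f := (Rintegral sigma S f).
Let mS := @measurable_hsphere R n.
Let sS : sigma S = 1%E := sigma_inv.1.

Lemma bounded_meas_rotation (T : 'cV[quat R]_n -> 'cV[quat R]_n) (g : borelH R n -> R) :
  rotation T -> bounded_meas S g -> bounded_meas S (g \o T).
Proof.
move=> rT [mg [M M0 gM]]; split.
  apply: measurableT_comp => //.
  by apply: isometry_measurable => y z; exact: rotation_sub.
by exists M => // x Sx; apply: gM; rewrite /hsphere /= rT.2.
Qed.

Lemma expect_rotation (T : 'cV[quat R]_n -> 'cV[quat R]_n) (g : borelH R n -> R) :
  rotation T -> bounded_meas S g -> E (g \o T) = E g.
Proof.
move=> rT bg; have [mg _] := bg.
have mT : measurable_fun setT (T : borelH R n -> borelH R n).
  by apply: isometry_measurable => y z; exact: rotation_sub.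
have TS : T @^-1` S = S.
  by apply/seteqP; split => x; rewrite /preimage /hsphere /= rT.2.
have bgT := bounded_meas_rotation rT bg.
rewrite /Rintegral; congr fine.
have -> : (\int[sigma]_(x in S) ((g \o T) x)%:E =
    \int[sigma]_(x in T @^-1` S) ((EFin \o g) \o T) x)%E.
  by rewrite TS.
rewrite (_ : (\int[sigma]_(x in T @^-1` S) ((EFin \o g) \o T) x =
    \int[pushforward sigma (T : borelH R n -> borelH R n)]_(y in S) (EFin \o g) y)%E).
  by apply: eq_measure_integral => A mA _; exact: sigma_inv.2.
apply/esym/integral_pushforward => //; first exact/measurable_EFinP.
by rewrite TS; exact: bounded_meas_integrable.
Qed.

End Invariance.

Section Gradient.
Variables (R : realType) (n : nat).
Local Notation S := (@hsphere R n : set (borelH R n)).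
Local Notation X := ('cV[quat R]_n).
Variable V : 'I_4 -> 'I_n * 'I_4 -> R.

Lemma bounded_meas_rc k : bounded_meas S (rc k : borelH R n -> R).
Proof.
split; first exact: measurable_rc.
by exists 1 => // x Sx; apply: le_trans (rc_le_hnorm k x) _; rewrite (Sx : hnorm x = 1).
Qed.

Lemma expands_rc k l j : k != l ->
  expands S (fun t x => rc j (plane_rot k l t x)) (rc j : borelH R n -> R)
    (fun x => if j == k then - rc l x else if j == l then rc k x else 0).
Proof.
move=> kl; split.
- exact: bounded_meas_rc.
- case: (j == k); [|case: (j == l)].
  + under eq_fun do rewrite -mulN1r; apply: bounded_measM; last exact: bounded_meas_rc.
    exact: bounded_meas_cst.
  + exact: bounded_meas_rc.
  + exact: bounded_meas_cst.
exists 1 => //; exists 1 => // t /ltW t1; split.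
  exact: (bounded_meas_rotation (rotation_plane_rot kl t1) (bounded_meas_rc j)).
move=> x Sx; rewrite of_rcK mul1r.
have n1 i : `|rc i x| <= 1.
  by apply: le_trans (rc_le_hnorm i x) _; rewrite (Sx : hnorm x = 1).
have t2 : 0 <= 1 - t ^+ 2 by rewrite subr_ge0 -(real_normK (num_real t)) expr_le1.
set c := Num.sqrt _.
have c0 : 0 <= c by exact: sqrtr_ge0.
have cE : c ^+ 2 = 1 - t ^+ 2 by rewrite sqr_sqrtr.
(* The cosine c lies in [0, 1], hence 1 - c <= 1 - c^2 = t^2: to first order only the sine
   contributes. *)
have c1 : `|c - 1| <= t ^+ 2 by rewrite ler_norml; nra.
have err y : `|y| <= 1 -> `|(c - 1) * y| <= t ^+ 2.
  by move=> y1; rewrite normrM -(mulr1 (t ^+ 2)) ler_pM.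
case: ifP => [/eqP ->|_]; first by apply: le_trans (err _ (n1 k)); rewrite le_eqVlt;
  apply/orP; left; apply/eqP; congr `|_|; ring.
case: ifP => [/eqP ->|_]; first by apply: le_trans (err _ (n1 l)); rewrite le_eqVlt;
  apply/orP; left; apply/eqP; congr `|_|; ring.
by rewrite mulr0 addr0 subrr normr0 sqr_ge0.
Qed.

(** Here dG a plays the part of the partial derivative of G in the linear form y_a = sum_k V a k
    x_k. The generator of the rotations in the plane (k, l) sends y_a to x_k V a l - x_l V a k, so
    the sum is the chain rule. *)
Definition has_gradient (G : X -> R) (dG : 'I_4 -> X -> R) :=
  (forall a, bounded_meas S (dG a : borelH R n -> R)) /\
  forall k l, k != l -> expands S (fun t x => G (plane_rot k l t x)) (G : borelH R n -> R)
    (fun x => \sum_a dG a x * (rc k x * V a l - rc l x * V a k)).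

Lemma has_gradient_cst c : has_gradient (cst c) (fun _ => cst 0).
Proof.
split=> [a|k l kl]; first exact: bounded_meas_cst.
apply: (expands_ext _ _ _ (expands_cst (bounded_meas_cst S c))) => // x.
by rewrite big1// => a _; rewrite mul0r.
Qed.

Lemma has_gradientD F dF G dG : has_gradient F dF -> has_gradient G dG ->
  has_gradient (fun x => F x + G x) (fun a x => dF a x + dG a x).
Proof.
move=> [bF eF] [bG eG]; split=> [a|k l kl]; first exact: bounded_measD.
apply: (expands_ext _ _ _ (expandsD (eF k l kl) (eG k l kl))) => // x.
by rewrite -big_split; apply: eq_bigr => a _; rewrite mulrDl.
Qed.

Lemma has_gradient_bounded F dF : (0 < n)%N -> has_gradient F dF ->
  bounded_meas S (F : borelH R n -> R).
Proof.
(* Boundedness of F is part of [expands], which is available only for two distinct coordinates; n >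
   0 provides them. *)
move=> n0 [_ /(_ (Ordinal n0, ord0) (Ordinal n0, ord_max))].
by case.
Qed.

Lemma has_gradientM F dF G dG : (0 < n)%N -> has_gradient F dF -> has_gradient G dG ->
  has_gradient (fun x => F x * G x) (fun a x => F x * dG a x + dF a x * G x).
Proof.
move=> n0 hF hG; have bF0 := has_gradient_bounded n0 hF.
have bG0 := has_gradient_bounded n0 hG.
move: hF hG => [bF eF] [bG eG]; split=> [a|k l kl].
  by apply: bounded_measD; exact: bounded_measM.
apply: (expands_ext _ _ _ (expandsM (eF k l kl) (eG k l kl))) => // x.
rewrite mulr_sumr mulr_suml -big_split; apply: eq_bigr => a _ /=; ring.
Qed.

Lemma has_gradientX F dF k : (0 < n)%N -> has_gradient F dF ->
  has_gradient (fun x => F x ^+ k) (fun a x => k%:R * F x ^+ k.-1 * dF a x).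
Proof.
move=> n0 hF; have bF0 := has_gradient_bounded n0 hF.
move: hF => [bF eF]; split=> [a|i j ij].
  apply: bounded_measM => //; apply: bounded_measM; first exact: bounded_meas_cst.
  exact: bounded_measX.
apply: (expands_ext _ _ _ (expandsX k (eF i j ij))) => // x.
by rewrite mulr_sumr; apply: eq_bigr => a _ /=; ring.
Qed.

Lemma has_gradientV F dF c : (0 < n)%N -> has_gradient F dF -> 0 < c ->
  (forall x, S x -> c <= F x) ->
  has_gradient (fun x => (F x)^-1) (fun a x => - dF a x / F x ^+ 2).
Proof.
move=> n0 hF c0 cF; have bF0 := has_gradient_bounded n0 hF.
move: hF => [bF eF]; split=> [a|i j ij].
  apply: bounded_measM.
    by under eq_fun do rewrite -mulN1r; apply: bounded_measM => //; exact: bounded_meas_cst.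
  under eq_fun do rewrite -exprVn; apply: bounded_measX.
  by case: bF0 => mF _; exact: (bounded_measV c0).
have cFT : exists2 e, 0 < e & forall t x, `|t| < e -> S x -> c <= F (plane_rot i j t x).
  exists 1 => // t x /ltW t1 Sx; apply: cF.
  by rewrite /hsphere /= (rotation_plane_rot ij t1).2.
apply: (expands_ext _ _ _ (expandsV (eF i j ij) c0 cFT)) => // x.
by rewrite -sumrN mulr_suml; apply: eq_bigr => a _ /=; ring.
Qed.

Definition lform a (x : X) : R := \sum_k V a k * rc k x.

Lemma has_gradient_lform b :
  has_gradient (lform b) (fun a _ => (a == b)%:R).
Proof.
split=> [a|k l kl]; first exact: bounded_meas_cst.
have main (r : seq ('I_n * 'I_4)) : expands S
    (fun t x => \sum_(j <- r) V b j * rc j (plane_rot k l t x))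
    ((fun x => \sum_(j <- r) V b j * rc j x) : borelH R n -> R)
    (fun x => \sum_(j <- r) V b j *
      (if j == k then - rc l x else if j == l then rc k x else 0)).
  elim: r => [|j r IH].
    apply: (expands_ext _ _ _ (expands_cst (bounded_meas_cst S 0))) => *;
    by rewrite big_nil.
  have := expandsD (expandsM (expands_cst (bounded_meas_cst S (V b j))) (expands_rc j kl)) IH.
  apply: expands_ext => *; rewrite big_cons //= mul0r addr0//.
apply: (expands_ext _ _ _ (main _)) => // x.
rewrite (bigD1 b)//= eqxx mul1r [X in _ = _ + X]big1 => [|a /negbTE ->]; last by rewrite mul0r.
rewrite (bigD1 k)//= (bigD1 l) 1?eq_sym//= eqxx eq_sym (negbTE kl) eqxx.
rewrite big1 => [|j /andP[/negbTE -> /negbTE ->]]; last by rewrite mulr0.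
by rewrite !addr0; ring.
Qed.

End Gradient.

Section Divergence.
Variables (R : realType) (n : nat) (n0 : (0 < n)%N) (sigma : probability (borelH R n) R).
Hypothesis sigma_inv : rotation_invariant_on_sphere sigma.
Local Notation S := (@hsphere R n : set (borelH R n)).
Local Notation X := ('cV[quat R]_n).
Local Notation E f := (Rintegral sigma S f).
Variable V : 'I_4 -> 'I_n * 'I_4 -> R.
Hypothesis Vortho : forall a b, \sum_k V a k * V b k = (a == b)%:R.
Let mS := @measurable_hsphere R n.
Let sS : sigma S = 1%E := sigma_inv.1.

(** Integration by parts on the sphere of dimension 4 n - 1: the tangential derivative of G in the
    direction V b has the same mean as (4 n - 1) y_b G. It is the sum over k and l of V b l times
    the derivative of x_k G under the rotations in the plane (k, l), each of which has mean 0. *)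
Lemma expect_gradient b (G : X -> R) dG : has_gradient V G dG ->
  E (fun x => (1 - (4 * n)%:R) * lform V b x * G x + dG b x
     - lform V b x * \sum_a lform V a x * dG a x) = 0.
Proof.
move=> hG; have bG0 := has_gradient_bounded n0 hG; have [bG eG] := hG.
pose D k l x := rc k x * (\sum_a dG a x * (rc k x * V a l - rc l x * V a k)) - rc l x * G x.
pose Q k l x := if k == l then 0 else V b l * D k l x.
have bD k l : k != l -> bounded_meas S (D k l : borelH R n -> R) /\ E (D k l) = 0.
  move=> kl; have h : expands S (fun t x => rc k (plane_rot k l t x) * G (plane_rot k l t x))
      ((fun x => rc k x * G x) : borelH R n -> R) (D k l : borelH R n -> R).
    apply: (expands_ext _ _ _ (expandsM (@expands_rc R n k l k kl) (eG k l kl))) => // x.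
    by rewrite eqxx /D mulNr.
  split; first by case: h.
  apply: (expect_expands_cst mS sS h); exists 1 => // t /ltW t1.
  apply: (expect_rotation sigma_inv (rotation_plane_rot kl t1) (g := fun x => rc k x * G x)).
  by apply: bounded_measM => //; exact: bounded_meas_rc.
have bQ k l : bounded_meas S (Q k l : borelH R n -> R).
  rewrite /Q; case: eqVneq => [_|kl]; first exact: (bounded_meas_cst S 0).
  by apply: bounded_measM; [exact: bounded_meas_cst|exact: (bD k l kl).1].
transitivity (E (fun x => \sum_k \sum_l Q k l x)); last first.
  rewrite (expect_sum mS sS)//; last by move=> k _; apply: bounded_meas_sum => l _; exact: bQ.
  rewrite big1// => k _; rewrite (expect_sum mS sS)//.
  rewrite big1// => l _; rewrite /Q; case: eqVneq => [_|kl]; first exact: (expect_cst mS sS).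
  by rewrite (expectZ sigma mS)//; [rewrite (bD k l kl).2 mulr0|exact: (bD k l kl).1].
apply: eq_expect => x Sx; apply/esym.
(* There is no rotation for k = l, where the general formula would give - V b l x_l G. Adding these
   terms back produces the 1 in 1 - 4 n. *)
have QE k l : Q k l x = V b l * (rc k x * (\sum_a dG a x * (rc k x * V a l - rc l x * V a k)))
    - V b l * rc l x * G x + (k == l)%:R * (V b l * rc l x * G x).
  rewrite /Q; case: eqVneq => [->|_]; last by rewrite mul0r addr0 /D mulrBr !mulrA.
  rewrite (_ : \sum_a _ = 0); first by rewrite !mulr0 sub0r mul1r addNr.
  by apply: big1 => a _; rewrite subrr mulr0.
under eq_bigr do under eq_bigr do rewrite QE.
have x1 : \sum_k rc k x ^+ 2 = 1 by rewrite -hnorm_sqr_rc (Sx : hnorm x = 1) expr1n.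
have card : \sum_(k : 'I_n * 'I_4) (1 : R) = (4 * n)%:R.
  by rewrite sumr_const card_prod !card_ord mulnC.
have e3 : \sum_k \sum_l (k == l)%:R * (V b l * rc l x * G x) = lform V b x * G x.
  rewrite /lform mulr_suml; apply: eq_bigr => k _.
  rewrite (bigD1 k)//= eqxx mul1r big1 ?addr0// => l /negbTE; rewrite eq_sym => ->.
  by rewrite mul0r.
have e2 : \sum_(k : 'I_n * 'I_4) \sum_l V b l * rc l x * G x = (4 * n)%:R * (lform V b x * G x).
  rewrite -card mulr_suml; apply: eq_bigr => k _.
  by rewrite mul1r /lform mulr_suml.
have e1 : \sum_k \sum_l V b l * (rc k x * (\sum_a dG a x * (rc k x * V a l - rc l x * V a k)))
   = dG b x - lform V b x * \sum_a lform V a x * dG a x.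
  transitivity (\sum_k \sum_l \sum_a (rc k x ^+ 2 * (dG a x * (V b l * V a l)) -
      (V b l * rc l x) * (V a k * rc k x * dG a x))).
    apply: eq_bigr => k _; apply: eq_bigr => l _; rewrite 2!mulr_sumr.
    by apply: eq_bigr => a _; ring.
  under eq_bigr do under eq_bigr do rewrite sumrB.
  under eq_bigr do rewrite sumrB.
  rewrite sumrB; congr (_ - _).
    under eq_bigr do rewrite exchange_big /=.
    under eq_bigr do under eq_bigr do rewrite -mulr_sumr -mulr_sumr Vortho.
    under eq_bigr do rewrite -mulr_sumr.
    rewrite -mulr_suml x1 mul1r (bigD1 b)//= eqxx mulr1 big1 ?addr0// => a /negbTE.
    by rewrite eq_sym => ->; rewrite mulr0.
  rewrite exchange_big /= /lform mulr_suml; apply: eq_bigr => l _.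
  rewrite exchange_big /= mulr_sumr; apply: eq_bigr => a _.
  by rewrite -mulr_sumr -mulr_suml.
under eq_bigr do rewrite big_split sumrB /=.
by rewrite big_split sumrB /= e1 e2 e3; ring.
Qed.

End Divergence.

(** * The mean of the Poisson kernel *)

Section Frame.
Variables (R : realType) (n : nat).
Implicit Types (u z : 'cV[quat R]_n) (a b : 'I_4).

Definition qunit a : quat R := (\row_j (j == a)%:R : 'rV[R]_4).

(** The coordinates of u e_a for e_a = 1, i, j, k. These four vectors span the quaternionic line of
    u, and pairing x with them gives the components of u^* x. *)
Definition frame u a (k : 'I_n * 'I_4) : R := rc k (\col_i (u i 0 * qunit a)).

Lemma qdot_sum (x y : quat R) :
  qdot x y = \sum_c (x : 'rV[R]_4) 0 c * (y : 'rV[R]_4) 0 c.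
Proof. by rewrite big_ord4. Qed.

Lemma qdot_unit a (x : quat R) : qdot (qunit a) x = (x : 'rV[R]_4) 0 a.
Proof.
rewrite qdot_sum (bigD1 a)//= mxE eqxx mul1r big1 ?addr0// => c /negbTE ca.
by rewrite mxE ca mul0r.
Qed.

Lemma sum_rc_qdot (w z : 'cV[quat R]_n) :
  \sum_k rc k w * rc k z = \sum_i qdot (w i 0) (z i 0).
Proof.
rewrite -(pair_bigA _ (fun i j => rc (i, j) w * rc (i, j) z)) /=.
by apply: eq_bigr => i _; rewrite qdot_sum.
Qed.

Lemma qdot_mul_conj (p x y : quat R) : qdot (p * x) y = qdot x (qconj p * y).
Proof. by rewrite /qdot /qconj !qring; ring. Qed.

Lemma qdot_sumr (x : quat R) (F : 'I_n -> quat R) :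
  qdot x (\sum_i F i) = \sum_i qdot x (F i).
Proof. by rewrite /qdot !q_sumE !mulr_sumr -!big_split. Qed.

Lemma lform_frame u a z : lform (frame u) a z = (hdot u z : 'rV[R]_4) 0 a.
Proof.
rewrite /lform /frame sum_rc_qdot -qdot_unit hdotE qdot_sumr.
by apply: eq_bigr => i _; rewrite mxE qdot_mul_conj.
Qed.

Lemma frame_ortho u a b : hnorm u = 1 ->
  \sum_k frame u a k * frame u b k = (a == b)%:R.
Proof.
move=> u1; rewrite /frame sum_rc_qdot.
transitivity (\sum_i qnorm2 (u i 0) * qdot (qunit a) (qunit b)).
  by apply: eq_bigr => i _; rewrite !mxE /qdot /qnorm2 !qring; ring.
by rewrite -mulr_suml -hnorm_sqr u1 expr1n mul1r qdot_unit mxE.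
Qed.

End Frame.

(** The derivative is required on the closed segment to have continuity at the end points for the
    mean value theorem. For this reason the mean over the ray is differentiated at every |r| < 1, so
    on both sides of 0. *)
Lemma derive0_segment (R : realType) (f : R -> R) (r : R) : 0 <= r ->
  (forall x, x \in `[0, r] -> is_derive x 1 f 0) -> f r = f 0.
Proof.
move=> r0 hf.
have hoo x : x \in `]0, r[ -> is_derive x 1 f (cst 0 x).
  move=> x0r; apply: hf; exact: subset_itv_oo_cc.
have h := @MVT_segment R f (cst 0) 0 r r0 hoo.
case: h => [|c _].
  by apply: derivable_within_continuous => x /hf; case.
by move=> e; apply/eqP; rewrite -subr_eq0 e mul0r.
Qed.

Section PoissonMean.
Variables (R : realType) (n : nat) (n0 : (0 < n)%N) (sigma : probability (borelH R n) R).
Hypothesis sigma_inv : rotation_invariant_on_sphere sigma.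
Local Notation S := (@hsphere R n : set (borelH R n)).
Local Notation X := ('cV[quat R]_n).
Local Notation E f := (Rintegral sigma S f).
Let mS := @measurable_hsphere R n.
Let sS : sigma S = 1%E := sigma_inv.1.
Variable u : X.
Hypothesis u1 : hnorm u = 1.
Let V := frame u.
Local Notation y := (lform V).
Local Notation o0 := (inord 0 : 'I_4).

Let W (x : X) : R := \sum_a y a x ^+ 2.
Let D (r : R) (x : X) : R := 1 - 2 * r * y o0 x + r ^+ 2 * W x.

Lemma gauge_ray r x : gauge (qreal r *: u) x ^+ 2 = D r x.
Proof.
have Wx : W x = qnorm2 (hdot u x).
  by rewrite qnorm2_sum; apply: eq_bigr => a _; rewrite lform_frame.
rewrite /D Wx lform_frame -/(q0 _) gauge_sqr.
have -> : hdot (qreal r *: u) x = qreal r * hdot u x.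
  rewrite !hdotE mulr_sumr; apply: eq_bigr => i _; rewrite mxE mulrA; congr (_ * _).
  by apply: quatP; rewrite /qconj /qreal !qring; split; ring.
by rewrite /qnorm2 /qreal !qring; ring.
Qed.

Lemma hnorm_ray r : hnorm (qreal r *: u) = `|r|.
Proof. by rewrite hnorm_scale u1 mulr1. Qed.

Lemma ray_denominator_ge r x : S x -> `|r| <= 1 -> (1 - `|r|) ^+ 2 <= D r x.
Proof.
move=> Sx r1; rewrite -gauge_ray lerXn2r ?nnegrE ?subr_ge0 ?hnorm_ge0//.
by apply: le_trans (gauge_ge _ _); rewrite hnorm_ray (Sx : hnorm x = 1) mulr1.
Qed.

Lemma has_gradient_ext F dF G dG : F =1 G -> (forall a x, dF a x = dG a x) ->
  has_gradient V F dF -> has_gradient V G dG.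
Proof.
move=> /funext -> FG; suff -> : dF = dG by [].
by apply: funext => a; apply: funext => x.
Qed.

Let hY a : has_gradient V (y a) (fun b _ => (b == a)%:R).
Proof. exact: has_gradient_lform. Qed.

Lemma inord_eq i j : (i < 4)%N -> (j < 4)%N -> (inord i == inord j :> 'I_4) = (i == j).
Proof. by move=> i4 j4; rewrite -val_eqE /= !inordK. Qed.

Lemma ord4P (P : 'I_4 -> Prop) : P (inord 0) -> P (inord 1) -> P (inord 2) -> P (inord 3) ->
  forall a, P a.
Proof.
move=> ? ? ? ? a; rewrite -(inord_val a).
by case: a => -[|[|[|[|//]]]].
Qed.

Let hW : has_gradient V W (fun a x => 2 * y a x).
Proof.
apply: has_gradient_ext (has_gradientD (has_gradientD (has_gradientD
  (has_gradientX 2 n0 (hY (inord 0))) (has_gradientX 2 n0 (hY (inord 1))))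
  (has_gradientX 2 n0 (hY (inord 2)))) (has_gradientX 2 n0 (hY (inord 3)))).
  by move=> x; rewrite /W big_ord4.
by move=> a x; elim/ord4P: a; rewrite !inord_eq//= ?expr1; ring.
Qed.

Let hD r : has_gradient V (D r) (fun a x => - 2 * r * (a == o0)%:R + 2 * r ^+ 2 * y a x).
Proof.
apply: has_gradient_ext (has_gradientD (has_gradientD (has_gradient_cst V 1)
  (has_gradientM n0 (has_gradient_cst V (- 2 * r)) (hY o0)))
  (has_gradientM n0 (has_gradient_cst V (r ^+ 2)) hW)).
  by move=> x; rewrite /D /cst; ring.
by move=> a x; rewrite /cst /=; ring.
Qed.

Let m := (2 * n).+1.

Let ray_integrand r x := (D r x)^-1 ^+ m.+1 * ((1 + r ^+ 2) * y o0 x - r * (1 + W x)).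

Let bounded_ray_integrand r : `|r| < 1 -> bounded_meas S (ray_integrand r : borelH R n -> R).
Proof.
move=> r1; have c0 : 0 < (1 - `|r|) ^+ 2 by rewrite exprn_gt0// subr_gt0.
have hc x : S x -> (1 - `|r|) ^+ 2 <= D r x.
  by move=> Sx; apply: ray_denominator_ge => //; exact: ltW.
have bD := has_gradient_bounded n0 (hD r); have bW := has_gradient_bounded n0 hW.
have bY b := has_gradient_bounded n0 (hY b).
apply: bounded_measM.
  by apply: bounded_measX; case: bD => mD _; exact: (bounded_measV c0).
apply: bounded_measD.
  by apply: bounded_measM => //; exact: bounded_meas_cst.
under eq_fun do rewrite -mulrN; apply: bounded_measM; first exact: bounded_meas_cst.
under eq_fun do rewrite -mulN1r; apply: bounded_measM; first exact: bounded_meas_cst.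
by apply: bounded_measD => //; exact: bounded_meas_cst.
Qed.

(** Apply [expect_gradient] to F_b = D^-m (delta_b0 (1 + W) - y_0 y_b) in the direction b and sum
    over b. Write F_b = D^-m G_b. Then sum_b y_b G_b = y_0, the divergence of G in the y_b is -3
    y_0, and its radial derivative contracted with y vanishes, so the terms without a derivative of
    D^-m amount to (1 - 4 n - 3) y_0 D^-m = -2 m y_0 D^-m. The derivatives of D^-m bring the factor
    m D^-(m+1), and the total is -2 m times the integrand. *)
Lemma expect_ray_identity r : `|r| < 1 ->
  E (ray_integrand r) = 0.
Proof.
move=> r1; have c0 : 0 < (1 - `|r|) ^+ 2 by rewrite exprn_gt0// subr_gt0.
have hc x : S x -> (1 - `|r|) ^+ 2 <= D r x.
  by move=> Sx; apply: ray_denominator_ge => //; exact: ltW.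
have hH := has_gradientX m n0 (has_gradientV n0 (hD r) c0 hc).
set H := fun x => _ in hH; set dH := fun a => _ in hH.
have hF b : has_gradient V (fun x => H x * ((b == o0)%:R * (1 + W x) - y o0 x * y b x))
    (fun a x => H x * (2 * (b == o0)%:R * y a x - y o0 x * (a == b)%:R - (a == o0)%:R * y b x)
     + dH a x * ((b == o0)%:R * (1 + W x) - y o0 x * y b x)).
  apply: has_gradient_ext (has_gradientM n0 hH (has_gradientD
    (has_gradientM n0 (has_gradient_cst V (b == o0)%:R)
      (has_gradientD (has_gradient_cst V 1) hW))
    (has_gradientM n0 (has_gradient_cst V (-1)) (has_gradientM n0 (hY o0) (hY b))))).
    by move=> x; rewrite /cst /=; ring.
  by move=> a x; rewrite /cst /=; ring.
have h0 b := expect_gradient n0 sigma_inv (fun a b => frame_ortho a b u1) b (hF b).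
have bF b := has_gradient_bounded n0 (hF b).
have bY b := has_gradient_bounded n0 (hY b).
pose star b x := (1 - (4 * n)%:R) * y b x * (H x * ((b == o0)%:R * (1 + W x) - y o0 x * y b x))
  + (H x * (2 * (b == o0)%:R * y b x - y o0 x * (b == b)%:R - (b == o0)%:R * y b x)
     + dH b x * ((b == o0)%:R * (1 + W x) - y o0 x * y b x))
  - y b x * \sum_a y a x *
     (H x * (2 * (b == o0)%:R * y a x - y o0 x * (a == b)%:R - (a == o0)%:R * y b x)
     + dH a x * ((b == o0)%:R * (1 + W x) - y o0 x * y b x)).
have bstar b : bounded_meas S (star b : borelH R n -> R).
  have bdF a := (hF b).1 a.
  apply: bounded_measD; first apply: bounded_measD.
  - by apply: bounded_measM => //; apply: bounded_measM => //; exact: bounded_meas_cst.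
  - exact: bdF.
  - under eq_fun do rewrite -mulN1r; apply: bounded_measM; first exact: bounded_meas_cst.
    apply: bounded_measM => //; apply: bounded_meas_sum => a _.
    by apply: bounded_measM => //; exact: bdF.
have : E (fun x => \sum_b star b x) = 0.
  by rewrite (expect_sum mS sS)// big1// => b _; exact: h0.
have k0 : (- 2 * m%:R : R) != 0 by rewrite mulf_neq0 ?oppr_eq0 ?pnatr_eq0.
move=> hs; apply: (mulfI k0); rewrite mulr0 -[RHS]hs.
rewrite -(expectZ sigma mS); last exact: bounded_ray_integrand.
apply: eq_expect => x Sx.
have Dx : D r x != 0 by rewrite gt_eqF// (lt_le_trans c0)// hc.
rewrite /ray_integrand big_ord4 /star !big_ord4 /H /dH !eqxx !inord_eq//=.
rewrite (_ : (4 * n)%:R = 4 * n%:R :> R); last by rewrite natrM.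
rewrite (_ : m%:R = 2 * n%:R + 1 :> R); last by rewrite /m -natr1 natrM.
rewrite !exprS; move: ((D r x)^-1 ^+ (2 * n)) => e; move: Dx.
rewrite /D /W big_ord4; move: (y _ x) (y (inord 1) x) (y (inord 2) x) (y (inord 3) x).
by move=> y0 y1 y2 y3 Dx; field.
Qed.

Let ray_mean (r : R) : R := E (fun x => ((1 - r ^+ 2) / D r x) ^+ m).

Lemma ray_mean_expands r : `|r| < 1 ->
  exists2 e, 0 < e & exists2 K, 0 <= K & forall t, `|t| < e ->
    `|ray_mean (r + t) - ray_mean r| <= K * t ^+ 2.
Proof.
move=> r1; have bY b := has_gradient_bounded n0 (hY b).
have bW := has_gradient_bounded n0 hW.
have eR : expands S (fun t (_ : X) => r + t) (cst r : borelH R n -> R) (cst 1).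
  split; [exact: bounded_meas_cst|exact: bounded_meas_cst|].
  exists 1 => //; exists 0 => // t _; split; first exact: bounded_meas_cst.
  by move=> x _; rewrite /cst mulr1 subrr normr0 mul0r.
have eD : expands S (fun t => D (r + t)) (D r : borelH R n -> R)
    (fun x => - 2 * y o0 x + 2 * r * W x).
  apply: expands_ext (expandsD (expandsD (expands_cst (bounded_meas_cst S 1))
    (expandsM (expandsM (expands_cst (bounded_meas_cst S (- 2))) eR) (expands_cst (bY o0))))
    (expandsM (expandsX 2 eR) (expands_cst bW))).
  - by move=> t x; rewrite /D /cst /=; ring.
  - by move=> x; rewrite /D /cst /=; ring.
  - by move=> x; rewrite /cst /=; ring.
(* For |t| < e one has 1 - |r + t| >= e, hence D (r + t) >= e^2 on S. *)
pose e := (1 - `|r|) / 2; have e0 : 0 < e by rewrite divr_gt0// subr_gt0.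
have c0 : 0 < e ^+ 2 by rewrite exprn_gt0.
have cD : exists2 e', 0 < e' & forall t x, `|t| < e' -> S x -> e ^+ 2 <= D (r + t) x.
  exists e => // t x te Sx; have := ler_normD r t; rewrite /e in te * => rt.
  apply: le_trans (ray_denominator_ge Sx _); last lra.
  by rewrite lerXn2r ?nnegrE; lra.
have eP := expandsX m (expandsM (expandsD (expands_cst (bounded_meas_cst S 1))
  (expandsM (expands_cst (bounded_meas_cst S (- 1))) (expandsX 2 eR))) (expandsV eD c0 cD)).
have eP' : expands S (fun t x => ((1 - (r + t) ^+ 2) / D (r + t) x) ^+ m)
  ((fun x => ((1 - r ^+ 2) / D r x) ^+ m) : borelH R n -> R)
  (fun x => 2 * m%:R * (1 - r ^+ 2) ^+ (2 * n) * ray_integrand r x).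
  apply: expands_ext eP => [t x|x|x]; rewrite /cst /ray_integrand /=.
  - by congr (_ ^+ _); rewrite mulN1r.
  - by congr (_ ^+ _); rewrite mulN1r.
  - rewrite mulN1r !exprMn (exprS _ m) (exprS _ (2 * n)) -/(W x).
    (* [expands_ext] compares the functions at every x, also off the sphere where D may vanish;
       there both sides are 0 by the convention 0^-1 = 0. *)
    have [->|] := eqVneq (D r x) 0; first by rewrite expr0n /= !invr0; ring.
    move: ((D r x)^-1 ^+ (2 * n)) => d; rewrite /D; move: (y _ x) (W x) => a b D0.
    by field.
have [e1 e10 [K K0 h]] := expect_expands mS sS eP'.
exists e1 => //; exists K => // t /h.
rewrite (expectZ sigma mS); last exact: bounded_ray_integrand.
by rewrite expect_ray_identity// !mulr0 addr0.
Qed.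

Lemma is_derive_ray_mean (r : R) : `|r| < 1 -> is_derive r 1 ray_mean 0.
Proof.
move=> r1; have [e e0 [K K0 h]] := ray_mean_expands r1.
have lim0 : (fun t => t^-1 *: (ray_mean (t *: 1 + r) - ray_mean r)) @ 0^' --> (0 : R).
  apply/cvgrPdist_le => eps eps0; near=> t.
  have tn0 : t != 0 by near: t; exact: nbhs_dnbhs_neq.
  have te : `|t| < e by near: t; apply: dnbhs0_lt.
  have tK : `|t| <= eps / (K + 1).
    by near: t; apply: dnbhs0_le; rewrite divr_gt0//; lra.
  rewrite sub0r normrN normrZ normfV /GRing.scale /= mulr1 (addrC t).
  rewrite ler_pdivrMl ?normr_gt0//; apply: le_trans (h t te) _.
  rewrite -(real_normK (num_real t)) expr2 mulrCA ler_wpM2l//.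
  move: tK; rewrite ler_pdivlMr; last lra.
  have := normr_ge0 t; nra.
apply: DeriveDef; first by apply/cvg_ex; exists 0.
exact: cvg_lim.
Unshelve. all: by end_near. Qed.

Lemma ray_mean1 r : 0 <= r -> r < 1 -> ray_mean r = 1.
Proof.
move=> r0 r1.
have <- : ray_mean 0 = 1.
  rewrite -[RHS](expect_cst mS sS 1); apply: eq_expect => x _.
  have -> : D 0 x = 1 by rewrite /D; ring.
  by rewrite expr0n subr0 divr1 expr1n.
have hr x : x \in `[0, r] -> is_derive x 1 ray_mean 0.
  rewrite in_itv /= => /andP[x0 xr]; apply: is_derive_ray_mean.
  by rewrite ger0_norm//; exact: le_lt_trans r1.
exact: derive0_segment hr.
Qed.

Lemma poisson_kernel_ray_mean r : 0 <= r -> r < 1 ->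
  E (poisson_kernel (qreal r *: u) : borelH R n -> R) = 1.
Proof.
move=> r0 r1; rewrite -[RHS](ray_mean1 r0 r1); apply: eq_expect => x _.
by rewrite poisson_kernelE gauge_ray hnorm_ray real_normK ?num_real.
Qed.

End PoissonMean.

(** * A weak type estimate for quasi-metric balls *)

Section WeakType.
Context d (T : measurableType d) (R : realType) (mu : probability T R) (S : set T).
Variables (rho : T -> T -> R) (f : T -> R) (C : R) (m : nat).
Hypotheses (mS : measurable S) (m0 : (0 < m)%N) (C0 : 0 <= C).

Definition gball z t := S `&` [set x | rho z x < t].

Hypothesis mball : forall z t, measurable (gball z t).
Hypothesis rhoC : forall z x, rho z x = rho x z.
Hypothesis rho_triangle : forall z y x, S z -> S y -> S x ->
  rho z x <= 2 * (rho z y + rho y x).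
Hypothesis volume : forall z t, S z -> 0 < t -> (mu (gball z t) <= ((C * t) ^+ m)%:E)%E.
Hypothesis intf : mu.-integrable S (EFin \o f).
Hypothesis f0 : forall x, S x -> 0 <= f x.

Local Notation J A := (Rintegral mu A f).

Lemma mass_setD (A U : set T) : measurable A -> measurable U -> A `<=` U -> U `<=` S ->
  J U = J A + J (U `\` A).
Proof.
move=> mA mU AU US; rewrite -[in LHS](setDUK AU) Rintegral_setU//.
- exact: measurableD.
- by rewrite setDUK//; exact: integrableS intf.
- by rewrite disj_set2E setDE setICA setICr setI0.
Qed.

Lemma mass_ge0 (A : set T) : A `<=` S -> 0 <= J A.
Proof. by move=> AS; apply: Rintegral_ge0 => x /AS; exact: f0. Qed.

(* The greedy choice of balls of almost maximal radius stops after [k] steps, since the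
   chosen balls are disjoint and have mass at least [c] each. *)
Lemma greedy_cover (lam c M : R) (k : nat) : 0 < lam -> 0 < c ->
  forall (F : set (T * R)) (U : set T), measurable U -> U `<=` S -> J U <= k%:R * c ->
  (forall p, F p -> [/\ S p.1, 0 < p.2 <= M, gball p.1 p.2 `<=` U,
    lam * p.2 ^+ m <= J (gball p.1 p.2) & c <= J (gball p.1 p.2)]) ->
  exists W, [/\ measurable W, forall p, F p -> W p.1 &
    (mu W <= ((6 * C) ^+ m / lam * J U)%:E)%E].
Proof.
move=> lam0 c0; elim: k => [|k IH] F U mU US JU hF.
  exists set0; split => // [p /hF[_ _ pU _ cJ]|]; last first.
    rewrite measure0 lee_fin mulr_ge0 ?mass_ge0// divr_ge0 ?exprn_ge0 ?mulr_ge0//.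
    exact: ltW.
  have := mass_setD (mball p.1 p.2) mU pU US.
  have : 0 <= J (U `\` gball p.1 p.2) by apply: mass_ge0 => x [/US].
  by move: JU; rewrite mul0r; lra.
have [F0|/set0P[p0 Fp0]] := eqVneq F set0.
  exists set0; split => // [p|]; first by rewrite F0.
  rewrite measure0 lee_fin mulr_ge0 ?mass_ge0// divr_ge0 ?exprn_ge0 ?mulr_ge0//.
  exact: ltW.
(* The supremum of the radii need not be attained, whence the factor 2. *)
have [p1 Fp1 p1max] : exists2 p1, F p1 & forall p, F p -> p.2 <= 2 * p1.2.
  pose Q := [set p.2 | p in F].
  have supQ : has_sup Q.
    split; first by exists p0.2; exists p0.
    by exists M => _ [p /hF[_ /andP[_ pM] _ _ _] <-].
  have s0 : 0 < sup Q.
    have [_ /andP[p00 _] _ _ _] := hF _ Fp0; apply: lt_le_trans p00 _.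
    by apply: sup_upper_bound => //; exists p0.
  have s20 : 0 < sup Q / 2 by rewrite divr_gt0.
  have [_ [p1 Fp1 <-] sp1] := sup_adherent s20 supQ.
  exists p1 => // p Fp; have : p.2 <= sup Q by apply: sup_upper_bound => //; exists p.
  lra.
have [Sp1 /andP[t10 t1M] B1U lamB1 cB1] := hF _ Fp1.
set B1 := gball p1.1 p1.2 in B1U lamB1 cB1.
have mB1 : measurable B1 by exact: mball.
have JE : J U = J B1 + J (U `\` B1) by apply: mass_setD.
pose F' := F `&` [set p | gball p.1 p.2 `&` B1 = set0].
have [||||W [mW WF muW]] := IH F' (U `\` B1).
- exact: measurableD.
- by move=> x [/US].
- by move: JU; rewrite JE -natr1 mulrDl mul1r; lra.
- move=> p [/hF[Sp pM pU lamp cp] pB1]; split => //.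
  move=> x xp; split; first exact: pU.
  by move=> xB1; have : set0 x by rewrite -pB1.
(* Only the centres have to be covered. If the ball of p meets B1 at x, then rho (p1, p) <= 2 (rho
   (p1, x) + rho (x, p)) < 2 (t1 + 2 t1), where t1 is the radius of B1; this is the 6. The other
   balls lie in U minus B1, where the induction applies. *)
exists (gball p1.1 (6 * p1.2) `|` W); split.
- exact: measurableU.
- move=> p Fp; have [Sp /andP[p20 _] _ _ _] := hF _ Fp.
  have [pB1|/set0P[x [[Sx px] [_ p1x]]]] := eqVneq (gball p.1 p.2 `&` B1) set0.
    by right; apply: WF.
  left; split => //=; apply: le_lt_trans (rho_triangle Sp1 Sx Sp) _.
  by rewrite /= (rhoC p.1) in px; move: (p1max p Fp) px p1x => /=; lra.
apply: le_trans (measureU2 _ _ _) _ => //.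
apply: le_trans (leeD (volume Sp1 _) muW) _; first by rewrite mulr_gt0.
rewrite -EFinD lee_fin JE mulrDr lerD2r.
rewrite mulrCA mulrA exprMn -mulrA ler_wpM2l// ?exprn_ge0 ?mulr_ge0//.
by rewrite ler_pdivlMl.
Qed.

(** [greedy_cover] needs a positive lower bound for the masses, so the radii are first kept above 1
    / (j + 1); the bound on mu W does not depend on j. *)
Lemma weak_type (lam : R) : 0 < lam ->
  exists W, [/\ measurable W,
    forall z, S z -> (exists2 t, 0 < t & lam * t ^+ m < J (gball z t)) -> W z &
    (mu W <= ((6 * C) ^+ m / lam * J S)%:E)%E].
Proof.
move=> lam0.
pose F j := [set p : T * R |
  [/\ S p.1, (j.+1%:R)^-1 <= p.2 & lam * p.2 ^+ m < J (gball p.1 p.2)]].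
have BS z t : gball z t `<=` S by move=> x [].
have JB z t : J (gball z t) <= J S.
  by rewrite (mass_setD (mball z t) mS)// lerDl mass_ge0// => x [].
have /choice[W hW] j : exists W, [/\ measurable W, forall p, F j p -> W p.1 &
    (mu W <= ((6 * C) ^+ m / lam * J S)%:E)%E].
  pose c := lam * (j.+1%:R)^-1 ^+ m.
  have c0 : 0 < c by rewrite mulr_gt0// exprn_gt0// invr_gt0.
  pose k := `|Num.ceil (J S / c)|%N.
  (* For a radius t >= 1, lam t <= lam t^m <= J S, so 1 + J S / lam bounds all radii; k is at least
     the number of disjoint balls of mass c that S can hold. *)
  apply: (@greedy_cover lam c (1 + J S / lam) k) => //.
    rewrite -ler_pdivrMr//; apply: le_trans (ceil_ge _) _.
    by rewrite /k natr_absz ler_int ler_norm.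
  move=> p [Sp jp lp]; have p20 : 0 < p.2 by apply: lt_le_trans jp; rewrite invr_gt0.
  split => //.
  - rewrite p20 /=; have [p1|p1] := leP p.2 1.
      by apply: le_trans p1 _; rewrite lerDl divr_ge0 ?mass_ge0// ltW.
    apply: (@le_trans _ _ (J S / lam)); last by rewrite lerDr.
    rewrite ler_pdivlMr// mulrC; apply: le_trans (JB p.1 p.2); apply: le_trans (ltW lp).
    rewrite ler_pM2l//; case: m m0 => // m' _; rewrite exprS ler_pMr//.
    by rewrite exprn_ege1// ltW.
  - exact: ltW.
  - apply: le_trans (ltW lp); rewrite /c ler_pM2l// lerXn2r ?nnegrE ?invr_ge0// ltW//.
(* The sets W j are chosen independently and need not be nested. A ball of radius t belongs to F j
   for all large j, so its centre lies in the lower limit of the W j, which is the increasing union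
   of the A i and keeps the bound on the measure. *)
pose A i := \bigcap_(j in [set j | (i <= j)%N]) W j.
have mA i : measurable (A i).
  by apply: bigcap_measurable => [|j _]; [exists i => /=|have [] := hW j].
have ndA : nondecreasing_seq A.
  move=> i i' ii'; apply/subsetPset => x Ax j /= i'j; apply: Ax.
  exact: leq_trans ii' i'j.
exists (\bigcup_i A i); split.
- exact: bigcup_measurable.
- move=> z Sz [t t0 lt]; pose i := `|Num.ceil t^-1|%N; exists i => // j /= ij.
  have [_ /(_ (z, t)) h _] := hW j; apply: h; split => //=.
  rewrite invf_ple ?posrE//; apply: le_trans (ceil_ge _) _.
  apply: (@le_trans _ _ (`|Num.ceil t^-1|%N)%:R); first by rewrite natr_absz ler_int ler_norm.
  by rewrite ler_nat (leq_trans ij).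
- have cvgA : (mu \o A) i @[i --> \oo] --> mu (\bigcup_i A i).
    by apply: nondecreasing_cvg_mu => //; exact: bigcup_measurable.
  rewrite -(cvg_lim _ cvgA)//; apply: lime_le; first by apply/cvg_ex; eexists; exact: cvgA.
  apply: nearW => i; have [mW _] := hW i; apply: le_trans.
  by apply: le_measure; rewrite ?inE// => x; apply => /=.
Qed.

End WeakType.

(** * Estimates of the Poisson integral *)

(** The numerator 2 t - t^2 is at least t and g^2 is at most 4 t^2; the quotient is the origin of
    the 4 in [sigma_gball]. *)
Lemma kernel_ratio_ge (R : realType) (t g : R) : 0 < t -> t < 1 -> t <= g -> g <= 2 * t ->
  0 <= (4 * t)^-1 <= (1 - (1 - t) ^+ 2) / g ^+ 2.
Proof.
move=> t0 t1 tg g2; rewrite invr_ge0 ler_pdivlMr; last by rewrite exprn_gt0//; lra.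
rewrite [_^-1 * _]mulrC ler_pdivrMr; last lra.
apply/andP; split; first lra.
apply: (@le_trans _ _ ((2 * t) ^+ 2)); first by rewrite lerXn2r ?nnegrE//; lra.
nra.
Qed.

(** With b a bound for 1 - r, the terms of h are at most 2 alpha b + 2 b and 1 - r^2 <= 2 (1 - r) <=
    2 b. *)
Lemma approach_aux (R : realType) (alpha g a b r e : R) : 1 < alpha -> 0 <= r -> r < 1 ->
  a <= e -> e < alpha * (1 - r) -> 1 - r <= b -> g <= 2 * (a + b) + (1 - r ^+ 2) ->
  g <= (2 * alpha + 4) * b.
Proof.
move=> a1 r0 r1 ae ea rb h.
have : alpha * (1 - r) <= alpha * b by rewrite ler_wpM2l//; lra.
nra.
Qed.

Lemma poisson_ratio_le (R : realType) (k : nat) (r b g : R) :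
  0 <= r -> r < 1 -> 0 < b -> b <= g ->
  ((1 - r ^+ 2) / g ^+ 2) ^+ k <= (2 * (1 - r) / b ^+ 2) ^+ k.
Proof.
move=> r0 r1 b0 bg; have g0 : 0 < g by exact: lt_le_trans bg.
have h : 0 <= 1 - r ^+ 2 <= 2 * (1 - r) by apply/andP; split; nra.
have /andP[h0 h1] := h.
rewrite lerXn2r ?nnegrE ?divr_ge0 ?sqr_ge0//; first lra.
apply: ler_pM; rewrite ?invr_ge0 ?sqr_ge0//.
by rewrite lef_pV2 ?posrE ?exprn_gt0// lerXn2r ?nnegrE// ltW.
Qed.

Section PoissonEstimates.
Variables (R : realType) (n : nat) (n0 : (0 < n)%N) (sigma : probability (borelH R n) R).
Hypothesis sigma_inv : rotation_invariant_on_sphere sigma.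
Local Notation S := (@hsphere R n : set (borelH R n)).
Local Notation X := ('cV[quat R]_n).
Local Notation E f := (Rintegral sigma S f).
Local Notation P := (@poisson_kernel R n).
Local Notation m := (2 * n).+1.
Implicit Types (q z x : X) (t alpha lam : R).
Let mS : measurable S := @measurable_hsphere R n.
Let sS : sigma S = 1%E := sigma_inv.1.

Lemma gauge_ball_ge q x : S x -> 1 - hnorm q <= gauge q x.
Proof. by move=> Sx; have := gauge_ge q x; rewrite (Sx : hnorm x = 1) mulr1. Qed.

Lemma bounded_poisson q : hball q -> bounded_meas S (P q : borelH R n -> R).
Proof.
move=> q1; apply: bounded_measX; apply: bounded_measM; first exact: bounded_meas_cst.
have c0 : 0 < (1 - hnorm q) ^+ 2 by rewrite exprn_gt0// subr_gt0.
apply: (bounded_measV c0) => [x Sx|].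
  by rewrite lerXn2r ?nnegrE ?gauge_ge0 ?gauge_ball_ge// subr_ge0 ltW.
by apply: measurable_funX; exact: measurable_gauge.
Qed.

Lemma poisson_ge0 q x : hball q -> 0 <= P q x.
Proof.
move=> q1; apply: exprn_ge0; rewrite divr_ge0 ?sqr_ge0// subr_ge0.
by rewrite expr_le1 ?hnorm_ge0// ltW.
Qed.

Lemma poisson_mean q : hball q -> E (P q : borelH R n -> R) = 1.
Proof.
(* The centre q = 0 lies on no distinguished ray; there the kernel is identically 1. *)
move=> q1; have [q0|q0] := eqVneq (hnorm q) 0.
  rewrite -[RHS](expect_cst mS sS 1); apply: eq_expect => x _.
  have g1 : gauge q x ^+ 2 = 1.
    rewrite gauge_sqr; suff -> : hdot q x = 0.
      by rewrite subr0 /qnorm2 !q1E; ring.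
    suff : qnorm2 (hdot q x) = 0.
      move: (hdot q x) => y; rewrite /qnorm2 => y0; apply: quatP; rewrite !q0E.
      by split; nra.
    apply/eqP; rewrite eq_le qnorm2_ge0 andbT.
    by have := qnorm2_hdot q x; rewrite q0 expr0n mul0r.
  by rewrite poisson_kernelE g1 q0 expr0n subr0 divr1 expr1n.
have q_gt0 : 0 < hnorm q by rewrite lt_def q0 hnorm_ge0.
pose u := qreal (hnorm q)^-1 *: q.
have u1 : hnorm u = 1.
  by rewrite hnorm_scale normfV gtr0_norm// mulVf.
have <- : qreal (hnorm q) *: u = q by rewrite scale_qreal divff// scale_qreal1.
by apply: (poisson_kernel_ray_mean n0 sigma_inv u1) => //; exact: ltW.
Qed.

Lemma gauge_dist q z : hnorm z = 1 -> gauge z q <= hnorm (z - q).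
Proof.
by move=> z1; have := gauge_sub z q z; rewrite gauge_self// z1 add0r mul1r.
Qed.

Local Notation B z t := (gball S (@gauge R n : borelH R n -> borelH R n -> R) z t).

Lemma measurable_gball z t : measurable (B z t).
Proof.
apply: measurableI => //.
have -> : [set x | gauge z x < t] = gauge z @^-1` `]-oo, t[.
  by apply/seteqP; split=> x /=; rewrite in_itv.
rewrite -[X in measurable X]setTI; apply: measurable_gauge => //.
Qed.

Lemma sigma_gball z t : S z -> 0 < t -> (sigma (B z t) <= ((4 * t) ^+ m)%:E)%E.
Proof.
move=> Sz t0; have [t1|t1] := leP 1 t.
  apply: le_trans (probability_le1 _ (measurable_gball z t)) _.
  by rewrite lee_fin exprn_ege1//; lra.
have [q [hq zq]] : exists q : X, hnorm q = 1 - t /\ hnorm (z - q) = t.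
  exists (qreal (1 - t) *: z).
  split; first by rewrite hnorm_scale (Sz : hnorm z = 1) mulr1 gtr0_norm// subr_gt0.
  by rewrite -{1}(scale_qreal1 z) scale_qrealB hnorm_scale (Sz : hnorm z = 1) mulr1
    opprB addrC subrK gtr0_norm.
have q1 : hball q by rewrite /hball /= hq; lra.
have PB x : B z t x -> (4 * t) ^- m <= P q x.
  move=> [Sx /= zx]; rewrite poisson_kernelE -exprVn hq.
  have tg : t <= gauge q x by have := gauge_ball_ge q Sx; rewrite hq opprB addrC subrK.
  have g2 : gauge q x <= 2 * t.
    have := gauge_sub x q z; rewrite (Sx : hnorm x = 1) mul1r (gaugeC x q) (gaugeC x z) zq.
    by move=> /le_trans; apply; rewrite mulr_natl mulr2n lerD2r ltW.
  have /andP[k0 k1] := kernel_ratio_ge t0 t1 tg g2.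
  by rewrite lerXn2r ?nnegrE// (le_trans k0).
have c0 : 0 < (4 * t) ^- m by rewrite invr_gt0 exprn_gt0//; lra.
rewrite -(@lee_pmul2l _ ((4 * t) ^- m)%:E)// -EFinM mulVf; last by rewrite gt_eqF// -invr_gt0.
have bP := bounded_poisson q1.
rewrite -(integral_cst sigma (measurable_gball z t)).
have <- : (\int[sigma]_(x in S) (P q x)%:E = 1)%E.
  rewrite -[LHS]fineK; last first.
    exact: (integrable_fin_num mS (bounded_meas_integrable sigma mS bP)).
  by congr (_%:E); exact: poisson_mean.
have mP A : measurable_fun A (EFin \o (P q : borelH R n -> R)).
  by apply/measurable_EFinP/measurable_funTS; case: bP.
apply: (@le_trans _ _ (\int[sigma]_(x in B z t) (P q x)%:E)%E).
  apply: ge0_le_integral => //.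
  - exact: measurable_gball.
  - by move=> x _; rewrite lee_fin ltW.
apply: ge0_subset_integral => //; first exact: measurable_gball.
- by move=> x _; rewrite lee_fin poisson_ge0.
- by move=> x [].
Qed.

Lemma bounded_meas_mul_integrable (b f : borelH R n -> R) :
  bounded_meas S b -> sigma.-integrable S (EFin \o f) ->
  sigma.-integrable S (EFin \o (fun x => b x * f x)).
Proof.
move=> [mb [M M0 bM]] intf.
have intMf : sigma.-integrable S (fun x => M%:E * (f x)%:E)%E by exact: integrableZl.
apply: le_integrable intMf => //.
  apply/measurable_EFinP; apply: measurable_funM; first exact: measurable_funTS.
  by apply/measurable_EFinP; case/integrableP: intf.
move=> x Sx /=; rewrite lee_fin !normrM ler_wpM2r//.
by apply: le_trans (bM x Sx) _; exact: ler_norm.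
Qed.

Lemma approach_gauge alpha z q x : 1 < alpha -> S z -> S x ->
  approach_region alpha z q -> gauge z x <= (2 * alpha + 4) * gauge q x.
Proof.
move=> a1 Sz Sx [q1 qz].
have := gauge_triangle (Sz : hnorm z = 1) (ltW q1) (Sx : hnorm x = 1).
apply: approach_aux a1 (hnorm_ge0 q) q1 _ qz (gauge_ball_ge q Sx).
by rewrite hnorm_subC; exact: gauge_dist.
Qed.

Lemma poisson_kernel_bound q x (b : R) : hball q -> 0 < b -> b <= gauge q x ->
  P q x <= (2 * (1 - hnorm q) / b ^+ 2) ^+ m.
Proof.
by move=> q1 b0 bq; exact: poisson_ratio_le (hnorm_ge0 q) q1 b0 bq.
Qed.

Lemma gauge_le2 z x : S z -> S x -> gauge z x <= 2.
Proof.
move=> Sz Sx; apply: le_trans (gauge_dist x (Sz : hnorm z = 1)) _.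
apply: le_trans (ler_hnormB z x) _.
by rewrite (Sz : hnorm z = 1) (Sx : hnorm x = 1) -[leRHS]/(1 + 1).
Qed.

Lemma sum_geometric_half_le2 k : \sum_(i < k) (2^-1 : R) ^+ i <= 2.
Proof.
suff : \sum_(i < k) (2^-1 : R) ^+ i = 2 - 2 * 2^-1 ^+ k.
  by move=> ->; rewrite gerBl mulr_ge0// exprn_ge0// invr_ge0.
elim: k => [|k IH]; first by rewrite big_ord0 expr0; ring.
by rewrite big_ord_recr /= IH exprS; field.
Qed.

(* On the shell [2^(k-1) A d <= gauge z x < 2^k A d], where [d = 1 - |q|] and
   [A = 2 alpha + 4], the kernel is at most [(8 / (4^k d))^m]. *)
Lemma maximal_estimate alpha z q lam (f : borelH R n -> R) : 1 < alpha -> S z ->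
  approach_region alpha z q -> sigma.-integrable S (EFin \o f) ->
  (forall x, S x -> 0 <= f x) -> 0 <= lam ->
  (forall t, 0 < t -> Rintegral sigma (B z t) f <= lam * t ^+ m) ->
  E (fun x => P q x * f x) <= 2 * (8 * (2 * alpha + 4)) ^+ m * lam.
Proof.
move=> a1 Sz Aq intf f0 lam0 Jlam; have [q1 _] := Aq.
set A := 2 * alpha + 4; have A0 : 0 < A by rewrite /A; lra.
set d := 1 - hnorm q; have d0 : 0 < d by rewrite subr_gt0.
pose t k := 2 ^+ k * A * d.
have t0 k : 0 < t k by rewrite !mulr_gt0// exprn_gt0.
pose c k := (8 / (4 ^+ k * d)) ^+ m.
have c0 k : 0 <= c k by rewrite exprn_ge0// divr_ge0// mulr_ge0 ?exprn_ge0// ltW.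
(* K is so large that the last gauge ball contains the whole sphere, on which the gauge is at most
   2; finitely many shells suffice. *)
pose K := `|Num.ceil (3 / (A * d))|%N.
have ceilK : 2 < t K.
  have h : 3 / (A * d) <= 2 ^+ K.
    apply: le_trans (ceil_ge _) _; apply: (@le_trans _ _ K%:R).
      by rewrite /K natr_absz ler_int ler_norm.
    by rewrite -natrX ler_nat ltnW// ltn_expl.
  by apply: (@lt_le_trans _ _ 3); rewrite ?ltr_nat// /t -mulrA -ler_pdivrMr// mulr_gt0.
have shell x : S x -> exists2 k : 'I_K.+1, gauge z x < t k & P q x <= c k.
  move=> Sx; have ex : exists k, gauge z x < t k.
    exists K; apply: le_lt_trans ceilK.
    exact: gauge_le2.
  case: (ex_minnP ex) => k zk kmin.
  have kK : (k < K.+1)%N.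
    rewrite ltnS; apply: kmin; apply: le_lt_trans ceilK.
    exact: gauge_le2.
  exists (Ordinal kK) => //=; rewrite /c.
  case: k zk kmin {kK} => [|k] zk kmin.
    apply: le_trans (poisson_kernel_bound q1 d0 (gauge_ball_ge q Sx)) _.
    rewrite lerXn2r ?nnegrE ?divr_ge0 ?mulr_ge0 ?sqr_ge0// ?(ltW d0)//.
    rewrite expr0 mul1r -/d (_ : 2 * d / d ^+ 2 = 2 / d); last by field; rewrite gt_eqF.
    by rewrite ler_pM2r ?invr_gt0// ler_nat.
  have b0 : 0 < 2 ^+ k * d by rewrite mulr_gt0// exprn_gt0.
  have bq : 2 ^+ k * d <= gauge q x.
    have : t k <= gauge z x by rewrite leNgt; apply/negP => /kmin; rewrite ltnn.
    move=> /le_trans/(_ (approach_gauge a1 Sz Sx Aq)).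
    by rewrite /t mulrAC mulrC -/A ler_pM2l.
  apply: le_trans (poisson_kernel_bound q1 b0 bq) _.
  rewrite -/d (_ : 2 * d / (2 ^+ k * d) ^+ 2 = 8 / (4 ^+ k.+1 * d))//.
  have -> : (4 : R) ^+ k.+1 = 4 * (2 ^+ k) ^+ 2.
    by rewrite exprS -exprM mulnC exprM; congr (_ * _ ^+ _); ring.
  field; rewrite (gt_eqF d0)/= expf_neq0//.
have mB k : measurable (B z (t k)) by exact: measurable_gball.
have bI k : bounded_meas S (\1_(B z (t k)) : borelH R n -> R).
  split; first exact: measurable_indic.
  by exists 1 => // x _; rewrite indicE; case: (_ \in _); rewrite ?normr1 ?normr0.
have intI k := bounded_meas_mul_integrable (bI k) intf.
have bS : bounded_meas S (fun x => \sum_(k < K.+1) c k * \1_(B z (t k)) x : R).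
  by apply: bounded_meas_sum => k _; apply: bounded_measM => //; exact: bounded_meas_cst.
apply: (@le_trans _ _ (E (fun x => (\sum_(k < K.+1) c k * \1_(B z (t k)) x) * f x))).
  apply: le_Rintegral => //; [exact: bounded_meas_mul_integrable (bounded_poisson q1) intf|
    exact: bounded_meas_mul_integrable bS intf|].
  move=> x Sx; rewrite ler_wpM2r ?f0//; have [k zk Pk] := shell x Sx.
  have xk : x \in B z (t k) by rewrite inE; split.
  rewrite (bigD1 k)//= indicE xk mulr1.
  apply: le_trans Pk _; rewrite lerDl sumr_ge0// => i _.
  by rewrite mulr_ge0// indicE ler0n.
have -> : E (fun x => (\sum_(k < K.+1) c k * \1_(B z (t k)) x) * f x) =
   \sum_(k < K.+1) c k * Rintegral sigma (B z (t k)) f.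
  have intc (k : 'I_K.+1) :
      sigma.-integrable S (EFin \o (fun x => c k * (\1_(B z (t k)) x * f x))).
    by apply: bounded_meas_mul_integrable (intI k); exact: bounded_meas_cst.
  have [_ sumE] := Rintegral_sum_integrable mS sS (index_enum 'I_K.+1) intc.
  transitivity (\sum_(k < K.+1) E (fun x => c k * (\1_(B z (t k)) x * f x))).
    rewrite -sumE; apply: eq_expect => x _; rewrite mulr_suml.
    by apply: eq_bigr => k _; rewrite mulrA.
  apply: eq_bigr => k _; rewrite RintegralZl//; congr (_ * _).
  have -> : B z (t k) = S `&` B z (t k) by rewrite /gball setIA setIid.
  rewrite Rintegral_mkcondr; apply: eq_expect => x Sx.
  by rewrite indicE patchE /gball setIA setIid; case: ifP; rewrite ?mul1r ?mul0r.
(* Since t_k grows like 2^k and c_k decays like 4^(-k m), c_k t_k^m = (8 A)^m 2^(-k m) <= (8 A)^m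
   2^-k, a geometric series of sum at most 2. *)
apply: (@le_trans _ _ (\sum_(k < K.+1) (8 * A) ^+ m * lam * 2^-1 ^+ k)).
  apply: ler_sum => k _; apply: (@le_trans _ _ (c k * (lam * t k ^+ m))).
    by rewrite ler_wpM2l// Jlam.
  have ratio : 8 / (4 ^+ k * d) * t k = 8 * A * 2^-1 ^+ k.
    rewrite /t exprVn; have -> : (4 : R) ^+ k = 2 ^+ k * 2 ^+ k.
      by rewrite -exprMn; congr (_ ^+ _); ring.
    by field; rewrite (gt_eqF d0)/= expf_neq0.
  rewrite /c mulrCA -exprMn ratio exprMn mulrA (mulrC lam).
  apply: ler_wpM2l; first by rewrite mulr_ge0// exprn_ge0// mulr_ge0// ltW.
  rewrite -exprM; apply: ler_wiXn2l; rewrite ?invr_ge0 ?invf_le1 ?ler1n//.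
  exact: leq_pmulr.
rewrite -mulr_sumr mulrC -mulrA; apply: ler_wpM2r; last exact: sum_geometric_half_le2.
by rewrite mulr_ge0// exprn_ge0// mulr_ge0// ltW.
Qed.

End PoissonEstimates.

(** * Almost everywhere convergence is closed in L^1 *)

(** Meant for exceptional sets whose measurability is not established: measurable covers of
    arbitrarily small measure are enough. *)
Lemma negligible_small d (T : measurableType d) (R : realType) (mu : probability T R)
    (A : set T) :
  (forall e : R, 0 < e -> exists W, [/\ measurable W, A `<=` W & (mu W <= e%:E)%E]) ->
  mu.-negligible A.
Proof.
move=> h; have /choice[W hW] (k : nat) : exists W, [/\ measurable W, A `<=` W &
    (mu W <= (k.+1%:R^-1)%:E)%E] by apply: h.
have mW : measurable (\bigcap_k W k) by apply: bigcapT_measurable => k; have [] := hW k.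
exists (\bigcap_k W k); split => //; last by move=> x Ax k _; have [_ + _] := hW k; apply.
apply/eqP; rewrite eq_le measure_ge0 andbT; apply/lee_addgt0Pr => e e0; rewrite add0e.
pose k := `|Num.ceil e^-1|%N; have [mWk _ Wk] := hW k.
apply: (@le_trans _ _ (mu (W k))).
  by apply: le_measure; rewrite ?inE//; exact: bigcap_inf.
apply: le_trans Wk _; rewrite lee_fin invf_ple ?posrE//.
apply: le_trans (ceil_ge _) _; apply: (@le_trans _ _ k%:R); last by rewrite ler_nat.
by rewrite /k natr_absz ler_int ler_norm.
Qed.

Section BoundedConvergence.
Context d (T : measurableType d) (R : realType) (mu : probability T R) (S : set T).
Hypotheses (mS : measurable S).

Lemma markov_cover (h : T -> R) (e : R) : 0 < e -> mu.-integrable S (EFin \o h) ->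
  (forall x, S x -> 0 <= h x) ->
  exists W, [/\ measurable W, forall z, S z -> e <= h z -> W z &
    (mu W <= (Rintegral mu S h / e)%:E)%E].
Proof.
move=> e0 inth h0; have [mh _] := integrableP _ _ _ inth.
exists (S `&` [set x | (e%:E <= `|(EFin \o h) x|)%E]); split.
- by apply: emeasurable_fun_c_infty => //; exact: measurableT_comp.
- by move=> z Sz ez; split => //=; rewrite lee_fin ger0_norm ?h0.
have := le_integral_abse mu mS mh e0.
have -> : (\int[mu]_(x in S) `|(EFin \o h) x| = (Rintegral mu S h)%:E)%E.
  rewrite /Rintegral fineK; last exact: integrable_fin_num.
  by apply: eq_integral => x /set_mem Sx /=; rewrite ger0_norm ?h0.
by rewrite mulrC EFinM -lee_pdivlMl// muleC.
Qed.

Lemma expect_bounded_cvg (u : nat -> T -> R) (v : T -> R) :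
  (forall k, measurable_fun setT (u k)) -> measurable_fun setT v ->
  (forall k x, `|u k x| <= 1) -> (forall x, u ^~ x @ \oo --> v x) ->
  forall e, 0 < e -> exists k, Rintegral mu S (fun x => `|u k x - v x|) <= e.
Proof.
move=> mu_ mv u1 uv e e0.
have mU k : measurable_fun S (EFin \o u k) by apply/measurable_EFinP/measurable_funTS.
have mV : measurable_fun S (EFin \o v) by apply/measurable_EFinP/measurable_funTS.
have cV : {ae mu, forall x, S x -> (EFin \o u k) x @[k --> \oo] --> (EFin \o v) x}.
  by apply: aeW => x _; apply/fine_cvgP; split; [exact: nearW|exact: uv].
have i1 : mu.-integrable S (EFin \o cst (1 : R)) by exact: finite_measure_integrable_cst.
have le1 : {ae mu, forall x k, S x -> (`|(EFin \o u k) x| <= (EFin \o cst (1%R : R)) x)%E}.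
  by apply: aeW => x k _; rewrite /= lee_fin.
have [_ + _] := dominated_convergence mS mU mV cV i1 le1.
move=> /fine_cvgP[_] /cvgrPdist_le/(_ e e0)[k _ /(_ k (leqnn k))] /=.
rewrite sub0r normrN => h; exists k; apply: le_trans h.
by apply: le_trans (ler_norm _); rewrite /Rintegral.
Qed.

End BoundedConvergence.

Section L1Closure.
Variables (R : realType) (n : nat) (n0 : (0 < n)%N) (sigma : probability (borelH R n) R).
Hypothesis sigma_inv : rotation_invariant_on_sphere sigma.
Variable alpha : R.
Hypothesis alpha1 : 1 < alpha.
Local Notation S := (@hsphere R n : set (borelH R n)).
Local Notation X := ('cV[quat R]_n).
Local Notation E f := (Rintegral sigma S f).
Local Notation P := (@poisson_kernel R n).
Local Notation m := (2 * n).+1.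
Local Notation L1 f := (sigma.-integrable S (EFin \o (f : borelH R n -> R))).
Implicit Types (q z x : X) (f g : X -> R).
Let mS : measurable S := @measurable_hsphere R n.
Let sS : sigma S = 1%E := sigma_inv.1.

Definition poisson_real f q : R := E (fun x => P q x * f x).

Definition converges_at f z := forall e, 0 < e -> exists2 d, 0 < d &
  forall q, approach_region alpha z q -> hnorm (q - z) < d -> `|poisson_real f q - f z| <= e.

Definition converges_ae f := sigma.-negligible (S `&` [set z | ~ converges_at f z]).

Lemma L1_poisson f q : hball q -> L1 f -> L1 (fun x => P q x * f x).
Proof. by move=> q1 intf; exact: bounded_meas_mul_integrable (bounded_poisson q1) intf. Qed.

Lemma L1_cst c : L1 (cst c).
Proof. exact: finite_measure_integrable_cst. Qed.

Lemma L1D f g : L1 f -> L1 g -> L1 (fun x => f x + g x).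
Proof. by move=> intf intg; exact: (integrableD mS intf intg). Qed.

Lemma L1Z c f : L1 f -> L1 (fun x => c * f x).
Proof.
move=> intf; exact: (bounded_meas_mul_integrable (bounded_meas_cst S c) intf).
Qed.

Lemma L1B f g : L1 f -> L1 g -> L1 (fun x => f x - g x).
Proof. by move=> intf intg; exact: (integrableB mS intf intg). Qed.

Lemma L1_norm f : L1 f -> L1 (fun x => `|f x|).
Proof. by move=> intf; exact: (integrable_norm intf). Qed.

Lemma poisson_realD f g q : hball q -> L1 f -> L1 g ->
  poisson_real (fun x => f x + g x) q = poisson_real f q + poisson_real g q.
Proof.
move=> q1 intf intg; rewrite /poisson_real -RintegralD//; [|exact: L1_poisson..].
by apply: eq_expect => x _; rewrite mulrDr.
Qed.

Lemma poisson_realZ c f q : hball q -> L1 f ->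
  poisson_real (fun x => c * f x) q = c * poisson_real f q.
Proof.
move=> q1 intf; rewrite /poisson_real -RintegralZl//; last exact: L1_poisson.
by apply: eq_expect => x _; rewrite mulrCA.
Qed.

Lemma poisson_realB f g q : hball q -> L1 f -> L1 g ->
  poisson_real (fun x => f x - g x) q = poisson_real f q - poisson_real g q.
Proof.
move=> q1 intf intg; rewrite /poisson_real -RintegralB//; [|exact: L1_poisson..].
by apply: eq_expect => x _; rewrite mulrBr.
Qed.

Lemma poisson_real_cst c q : hball q -> poisson_real (cst c) q = c.
Proof.
move=> q1; rewrite /poisson_real.
have -> : E (fun x => P q x * cst c x) = c * E (P q : borelH R n -> R).
  rewrite -(expectZ sigma mS); last exact: bounded_poisson.
  by apply: eq_expect => x _; rewrite mulrC.
by rewrite poisson_mean// mulr1.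
Qed.

Lemma poisson_real_norm f q : hball q -> L1 f ->
  `|poisson_real f q| <= poisson_real (fun x => `|f x|) q.
Proof.
move=> q1 intf; apply: le_trans (le_normr_Rintegral mS (L1_poisson q1 intf)) _.
rewrite le_eqVlt; apply/orP; left; apply/eqP; apply: eq_expect => x _.
by rewrite normrM ger0_norm// poisson_ge0.
Qed.

Lemma converges_ae_converges f : (forall z, S z -> converges_at f z) -> converges_ae f.
Proof.
by move=> fz; apply: negligibleS (@negligible_set0 _ _ _ sigma) => z [Sz] /(_ (fz z Sz)).
Qed.

Lemma converges_aeD f g : L1 f -> L1 g -> converges_ae f -> converges_ae g ->
  converges_ae (fun x => f x + g x).
Proof.
move=> intf intg gf gg; apply: negligibleS (negligibleU gf gg) => z [Sz nfg].
apply: contrapT => /not_orP[/not_andP[//|/contrapT cf] /not_andP[//|/contrapT cg]].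
apply: nfg => e e0; have e20 : 0 < e / 2 by rewrite divr_gt0.
have [d1 d10 h1] := cf _ e20; have [d2 d20 h2] := cg _ e20.
exists (Num.min d1 d2); first by rewrite lt_min d10.
move=> q Aq; rewrite lt_min => /andP[qd1 qd2].
rewrite poisson_realD//; last by case: Aq.
rewrite opprD addrACA [leRHS]splitr.
by apply: le_trans (ler_normD _ _) _; apply: lerD; [exact: h1|exact: h2].
Qed.

Lemma converges_aeZ c f : L1 f -> converges_ae f -> converges_ae (fun x => c * f x).
Proof.
move=> intf; apply: negligibleS => z [Sz nfg]; split => // cf; apply: nfg => e e0.
have c0 : 0 < `|c| + 1 by rewrite ltr_wpDl.
have [d d0 h] := cf (e / (`|c| + 1)) (divr_gt0 e0 c0).
exists d => // q Aq qd; rewrite poisson_realZ//; last by case: Aq.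
rewrite -mulrBr normrM; apply: le_trans (ler_wpM2l (normr_ge0 _) (h q Aq qd)) _.
rewrite mulrCA ler_piMr ?ltW// ltr_pdivrMr// mul1r ltrDl//.
Qed.

(** The weak type bound is used at level e / K, with K the constant of [maximal_estimate]. In 6 * 4
    the 6 comes from the covering and the 4 from the volume of gauge balls. *)
Lemma poisson_maximal f e : L1 f -> (forall x, S x -> 0 <= f x) -> 0 < e ->
  exists W, [/\ measurable (W : set (borelH R n)),
    forall z, S z -> ~ W z -> forall q, approach_region alpha z q -> poisson_real f q <= e &
    (sigma W <= ((6 * 4) ^+ m * (2 * (8 * (2 * alpha + 4)) ^+ m) / e * E f)%:E)%E].
Proof.
move=> intf f0 e0; set K := 2 * _.
have K0 : 0 < K.
  by rewrite mulr_gt0// exprn_gt0// mulr_gt0// addr_gt0// mulr_gt0// (lt_trans _ alpha1).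
have l0 : 0 < e / K by exact: divr_gt0.
have [||W [mW hW sW]] := @weak_type _ _ _ sigma S (@gauge R n) f 4 m mS (ltn0Sn _) (ler0n _ 4)
  (@measurable_gball R n) (@gaugeC R n) _ _ intf f0 _ l0.
- by move=> z y x; exact: gauge_quasi_triangle.
- by move=> z t Sz t0; exact: sigma_gball.
exists W; split => //.
- move=> z Sz nW q Aq.
  have h := maximal_estimate sigma_inv alpha1 Sz Aq intf f0 (ltW l0) _.
  apply: le_trans (h _) _; last by rewrite -/K mulrCA divff ?mulr1// gt_eqF.
  move=> t t0; rewrite leNgt; apply/negP => lt; apply: nW; apply: hW => //.
  by exists t.
- by rewrite invf_div mulrA in sW.
Qed.

(** With h = |f - g|, |P[f](q) - f(z)| <= P[h](q) + |P[g](q) - g(z)| + h(z). The first term is small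
    outside a set given by the maximal bound, the last by Markov's inequality, and the middle one by
    convergence for g: hence the factor 3. *)
Lemma converges_ae_closed f : L1 f ->
  (forall e, 0 < e -> exists g, [/\ L1 g, converges_ae g & E (fun x => `|f x - g x|) <= e]) ->
  converges_ae f.
Proof.
move=> intf happ.
pose bad j := S `&` [set z | ~ exists2 d, 0 < d & forall q, approach_region alpha z q ->
  hnorm (q - z) < d -> `|poisson_real f q - f z| <= 3 * j.+1%:R^-1].
suff hbad j : sigma.-negligible (bad j).
  apply: negligibleS (negligible_bigcup hbad) => z [Sz nc].
  apply: contrapT => nb; apply: nc => e e0.
  pose j := `|Num.ceil (3 / e)|%N.
  have je : 3 * j.+1%:R^-1 <= e.
    rewrite ler_pdivrMr// mulrC -ler_pdivrMr//; apply: le_trans (ceil_ge _) _.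
    apply: (@le_trans _ _ j%:R); last by rewrite ler_nat.
    by rewrite /j natr_absz ler_int ler_norm.
  have [d d0 h] : exists2 d, 0 < d & forall q, approach_region alpha z q ->
      hnorm (q - z) < d -> `|poisson_real f q - f z| <= 3 * j.+1%:R^-1.
    by apply: contrapT => nh; apply: nb; exists j.
  by exists d => // q Aq qd; apply: le_trans (h q Aq qd) je.
apply: negligible_small => r r0.
pose e : R := j.+1%:R^-1; have e0 : 0 < e by rewrite invr_gt0.
(* The sum of the maximal and the Markov constants at level e: an L^1 error r / K makes the two
   exceptional sets have total measure at most r. *)
pose K := (6 * 4) ^+ m * (2 * (8 * (2 * alpha + 4)) ^+ m) / e + 1 / e.
have K0 : 0 < K.
  apply: ltr_wpDl; last by rewrite divr_gt0.
  rewrite divr_ge0 ?(ltW e0)// mulr_ge0 ?exprn_ge0// mulr_ge0// exprn_ge0// mulr_ge0//.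
  by rewrite addr_ge0// mulr_ge0// ltW// (lt_trans _ alpha1).
have [g [intg gg fg]] := happ (r / K) (divr_gt0 r0 K0).
pose h x := `|f x - g x|.
have inth : L1 h by exact: L1_norm (L1B intf intg).
have h0 x : S x -> 0 <= h x by rewrite /h.
have [W1 [mW1 hW1 sW1]] := poisson_maximal inth h0 e0.
have [W2 [mW2 hW2 sW2]] := markov_cover mS e0 inth h0.
have [N [mN N0 hN]] := gg.
exists (N `|` (W1 `|` W2)); split.
- by apply: measurableU => //; exact: measurableU.
- move=> z [Sz nz]; apply: contrapT => /not_orP[nN /not_orP[nW1 nW2]].
  have cg : converges_at g z by apply: contrapT => ncg; apply: nN; apply: hN.
  have hz : h z <= e by rewrite leNgt; apply/negP => /ltW /(hW2 z Sz).
  have [d d0 hd] := cg _ e0; apply: nz; exists d => // q Aq qd.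
  have q1 : hball q by case: Aq.
  have p1 : `|poisson_real f q - poisson_real g q| <= e.
    rewrite -poisson_realB//; apply: le_trans (poisson_real_norm q1 (L1B intf intg)) _.
    exact: (hW1 z Sz nW1 q Aq).
  have p2 := hd q Aq qd.
  have -> : poisson_real f q - f z = (poisson_real f q - poisson_real g q) +
     (poisson_real g q - g z) + (g z - f z) by ring.
  rewrite -/e (_ : 3 * e = e + e + e); last by ring.
  apply: le_trans (ler_normD _ _) _; apply: lerD; last by rewrite distrC.
  by apply: le_trans (ler_normD _ _) _; exact: lerD.
- apply: le_trans (measureU2 _ _ _) _ => //; first exact: measurableU.
  have N0' : (sigma N <= 0)%E by rewrite N0.
  have sW : (sigma (W1 `|` W2) <= sigma W1 + sigma W2)%E by exact: measureU2.
  apply: le_trans (leeD N0' (le_trans sW (leeD sW1 sW2))) _.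
  rewrite add0e -EFinD lee_fin.
  have -> : r = K * (r / K) by rewrite mulrCA divff ?mulr1// gt_eqF.
  apply: le_trans (ler_wpM2l (ltW K0) fg).
  rewrite -/h /K; move: (E h) => Eh.
  by rewrite le_eqVlt; apply/orP; left; apply/eqP; ring.
Qed.

End L1Closure.

(** * Convergence for continuous functions, Borel sets and integrable functions *)

Lemma min1_lipschitz (R : realType) (a b : R) : `|Num.min 1 a - Num.min 1 b| <= `|a - b|.
Proof.
have h1 := ler_norm (a - b); have h2 := ler_norm (b - a); rewrite distrC in h2.
by rewrite ler_norml /Num.min; case: ltP => ?; case: ltP => ?; lra.
Qed.

(** The minimum with 1 makes the base both at most e and at most 1, so raising it to a positive
    power keeps it below e. *)
Lemma ratio_small (R : realType) (e b d y r : R) (k : nat) : 0 < b -> 0 <= r -> r <= d ->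
  d = Num.min 1 e * b ^+ 2 / 2 -> (2 * r / b ^+ 2) ^+ k.+1 <= e.
Proof.
move=> b0 r0 rd dE; have b2 : 0 < b ^+ 2 by rewrite exprn_gt0.
set w := 2 * r / b ^+ 2.
have w0 : 0 <= w by rewrite divr_ge0 ?mulr_ge0// ltW.
have wm : w <= Num.min 1 e by rewrite /w ler_pdivrMr//; lra.
have w1 : w <= 1 by apply: le_trans wm _; rewrite ge_min lexx.
have we : w <= e by apply: le_trans wm _; rewrite ge_min lexx orbT.
by apply: le_trans we; rewrite exprS ler_piMr// exprn_ile1.
Qed.

Section OpenApproximation.
Variables (R : realType) (n : nat) (U : set 'cV[quat R]_n).
Local Notation X := ('cV[quat R]_n).
Implicit Types x y : X.

Let radii x : set R := [set r | 0 <= r <= 1 /\ forall y, hnorm (y - x) < r -> U y].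

(** The distance from x to the complement of U, truncated at 1. As a supremum of radii it also makes
    sense when U is the whole space. *)
Definition codist x : R := sup (radii x).

Let radii0 x : radii x 0.
Proof. by split; [rewrite lexx ler01|move=> y; rewrite ltNge hnorm_ge0]. Qed.

Let has_sup_radii x : has_sup (radii x).
Proof. by split; [exists 0|exists 1 => r [/andP[]]]. Qed.

Lemma codist_ge0 x : 0 <= codist x.
Proof. exact: sup_upper_bound (has_sup_radii x) _ (radii0 x). Qed.

Lemma codist_sub x y : codist x <= codist y + hnorm (x - y).
Proof.
apply: ge_sup; first by exists 0.
move=> r [/andP[r0 r1] hr]; have [rxy|xyr] := leP r (hnorm (x - y)).
  by apply: le_trans rxy _; rewrite lerDr codist_ge0.
rewrite -lerBlDr; apply: sup_upper_bound (has_sup_radii y) _ _; split.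
  by rewrite subr_ge0 (ltW xyr)/= lerBlDr (le_trans r1)// lerDl hnorm_ge0.
move=> v vy; apply: hr; apply: le_lt_trans (hnorm_dist v y x) _.
by rewrite -ltrBrDr hnorm_subC in vy *; rewrite (hnorm_subC y x).
Qed.

Lemma codist_lipschitz x y : `|codist x - codist y| <= hnorm (x - y).
Proof.
rewrite ler_norml lerBlDl codist_sub andbT lerNl opprB lerBlDl.
by rewrite hnorm_subC codist_sub.
Qed.

Lemma codist_out x : ~ U x -> codist x = 0.
Proof.
move=> nUx; apply/eqP; rewrite eq_le codist_ge0 andbT; apply: ge_sup; first by exists 0.
move=> r [_ hr]; rewrite leNgt; apply/negP => r0; apply: nUx; apply: hr.
by rewrite subrr hnorm0.
Qed.

Lemma codist_in x : open U -> U x -> 0 < codist x.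
Proof.
move=> /open_hnorm/(_ x) oU /oU[e e0 he].
apply: (@lt_le_trans _ _ (Num.min 1 e)); first by rewrite lt_min ltr01.
apply: sup_upper_bound (has_sup_radii x) _ _; split.
  by rewrite le_min ler01 (ltW e0) ge_min lexx.
by move=> y; rewrite lt_min => /andP[_]; exact: he.
Qed.

Definition plateau (k : nat) x : R := Num.min 1 (k%:R * codist x).

Lemma plateau_ge0 k x : 0 <= plateau k x.
Proof. by rewrite le_min ler01 mulr_ge0// codist_ge0. Qed.

Lemma plateau_le1 k x : `|plateau k x| <= 1.
Proof. by rewrite ger0_norm ?plateau_ge0// ge_min lexx. Qed.

Lemma plateau_continuous k z : hcontinuous_at (plateau k) z.
Proof.
apply: (@hlipschitz_continuous _ _ _ k%:R) => // x y.
apply: le_trans (min1_lipschitz _ _) _.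
by rewrite -mulrBr normrM normr_nat ler_wpM2l// codist_lipschitz.
Qed.

Lemma plateau_cvg x : open U -> plateau ^~ x @ \oo --> (\1_U x : R).
Proof.
move=> oU; rewrite indicE; case: (boolP (x \in U)) => [/set_mem Ux|/negP nUx].
  have c0 := codist_in oU Ux.
  apply/cvgrPdist_le => e e0; pose k := `|Num.ceil (codist x)^-1|%N.
  exists k => // j /= kj.
  suff -> : plateau j x = 1 by rewrite subrr normr0 ltW.
  apply/min_idPl; rewrite -ler_pdivrMr// div1r; apply: le_trans (ceil_ge _) _.
  apply: (@le_trans _ _ k%:R); last by rewrite ler_nat.
  by rewrite /k natr_absz ler_int ler_norm.
have x0 : codist x = 0 by apply: codist_out => Ux; apply: nUx; exact: mem_set.
rewrite (_ : plateau ^~ x = cst 0); first exact: cvg_cst.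
by apply: funext => j; rewrite /plateau x0 mulr0; apply/min_idPr.
Qed.

End OpenApproximation.

Section AlmostEverywhere.
Variables (R : realType) (n : nat) (n0 : (0 < n)%N) (sigma : probability (borelH R n) R).
Hypothesis sigma_inv : rotation_invariant_on_sphere sigma.
Variable alpha : R.
Hypothesis alpha1 : 1 < alpha.
Local Notation S := (@hsphere R n : set (borelH R n)).
Local Notation X := ('cV[quat R]_n).
Local Notation E f := (Rintegral sigma S f).
Local Notation P := (@poisson_kernel R n).
Local Notation m := (2 * n).+1.
Local Notation L1 f := (sigma.-integrable S (EFin \o (f : borelH R n -> R))).
Local Notation converges_ae := (converges_ae sigma alpha).
Implicit Types (q z x : X) (f g : X -> R).
Let mS : measurable S := @measurable_hsphere R n.
Let sS : sigma S = 1%E := sigma_inv.1.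

Lemma L1_bounded g :
  measurable_fun setT (g : borelH R n -> R) -> (forall x, `|g x| <= 1) -> L1 g.
Proof.
by move=> mg g1; apply: (bounded_meas_integrable sigma mS); split => //; exists 1.
Qed.

(** Convergence holds at every point of S. By the mean value 1, g(z) = P[g(z)](q), and |g - g(z)| is
    split into a part near z, where continuity gives e / 2, and a far part, where the kernel itself
    tends to 0. *)
Lemma converges_ae_continuous g :
  (forall z, hcontinuous_at g z) -> (forall x, `|g x| <= 1) -> converges_ae g.
Proof.
move=> cg g1; have intg := L1_bounded (hcontinuous_measurable cg) g1.
apply: converges_ae_converges => z Sz e e0.
have e20 : 0 < e / 2 by rewrite divr_gt0.
have [d1 d10 hd1] := cg z _ e20.
have A0 : 0 < 2 * alpha + 4 by rewrite addr_gt0// mulr_gt0// (lt_trans _ alpha1).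
(* If |x - z| >= d1 then gauge z x >= d1^2 / 2, and [approach_gauge] gives gauge q x >= b. *)
pose b := d1 ^+ 2 / (2 * (2 * alpha + 4)).
have b0 : 0 < b by rewrite divr_gt0 ?exprn_gt0// mulr_gt0.
pose d := Num.min 1 (e / 4) * b ^+ 2 / 2.
have d0 : 0 < d.
  by rewrite divr_gt0// mulr_gt0 ?exprn_gt0// lt_min ltr01 divr_gt0.
exists d => // q Aq qd; have [q1 _] := Aq.
have rd : 1 - hnorm q <= d.
  have := ler_dist_hnorm q z; rewrite (Sz : hnorm z = 1) distrC => h.
  exact: le_trans (ler_norm _) (le_trans h (ltW qd)).
have r0 : 0 <= 1 - hnorm q by rewrite subr_ge0 ltW.
rewrite -(poisson_real_cst n0 sigma_inv (g z) q1) -poisson_realB//; last exact: L1_cst.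
have intB : L1 (fun x => g x - cst (g z) x) by apply: L1B => //; exact: L1_cst.
apply: le_trans (poisson_real_norm q1 intB) _.
have intP : L1 (P q) by exact: (bounded_meas_integrable sigma mS (bounded_poisson q1)).
(* A common majorant of P q |g - g(z)|: near z it is at most (e / 2) P q, far away at most (e / 4) 2
   = e / 2. Its mean is e. *)
have intPe : L1 (fun x => e / 2 * P q x + e / 2).
  by apply: L1D; [exact: L1Z|exact: L1_cst].
have <- : E (fun x => e / 2 * P q x + e / 2) = e.
  rewrite expectD//; last exact: bounded_meas_cst; last first.
    by apply: bounded_measM; [exact: bounded_meas_cst|exact: bounded_poisson].
  rewrite (expectZ sigma mS); last exact: bounded_poisson.
  by rewrite poisson_mean// mulr1 (expect_cst mS sS (e / 2)) -splitr.
apply: le_Rintegral => //; first exact: L1_poisson (L1_norm intB).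
move=> x Sx; have Pge0 := poisson_ge0 x q1.
have [xz|zx] := ltP (hnorm (x - z)) d1.
  apply: (@le_trans _ _ (e / 2 * P q x)); last by rewrite lerDl ltW.
  by rewrite mulrC ler_wpM2r// ltW// hd1.
apply: (@le_trans _ _ (e / 2)); last by rewrite lerDr mulr_ge0// ltW.
have bq : b <= gauge q x.
  rewrite /b ler_pdivrMr ?mulr_gt0//.
  apply: (@le_trans _ _ (2 * gauge z x)).
    apply: (@le_trans _ _ (hnorm (z - x) ^+ 2)).
      by rewrite hnorm_subC lerXn2r ?nnegrE ?hnorm_ge0// ltW.
    by apply: hnormB_sqr_le; rewrite ?(Sz : hnorm z = 1) ?(Sx : hnorm x = 1).
  rewrite mulrCA ler_pM2l// mulrC; exact: approach_gauge.
have Pe : P q x <= e / 4.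
  apply: le_trans (poisson_kernel_bound q1 b0 bq) _.
  exact: (@ratio_small _ (e / 4) b d 0).
have g2 : `|g x - cst (g z) x| <= 2.
  by apply: le_trans (ler_normB _ _) _; rewrite -[leRHS]/(1 + 1); apply: lerD; exact: g1.
apply: (@le_trans _ _ (e / 4 * 2)); first exact: ler_pM.
by rewrite le_eqVlt; apply/orP; left; apply/eqP; field.
Qed.

Lemma L1_indic (A : set (borelH R n)) : measurable A -> L1 (\1_A).
Proof.
move=> mA; apply: L1_bounded; first exact: measurable_indic.
by move=> x; rewrite indicE; case: (_ \in _); rewrite ?normr1 ?normr0.
Qed.

Lemma converges_ae_limit (u : nat -> X -> R) (v : X -> R) :
  (forall k, measurable_fun setT (u k : borelH R n -> R)) ->
  measurable_fun setT (v : borelH R n -> R) ->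
  (forall k x, `|u k x| <= 1) -> (forall x, `|v x| <= 1) ->
  (forall x, u ^~ x @ \oo --> v x) -> (forall k, converges_ae (u k)) -> converges_ae v.
Proof.
move=> mu mv u1 v1 uv gu.
apply: (converges_ae_closed n0 sigma_inv alpha1 (L1_bounded mv v1)) => e e0.
have [k hk] := @expect_bounded_cvg _ (borelH R n) R sigma S mS u v mu mv u1 uv e e0.
exists (u k); split => //; first exact: L1_bounded.
apply: le_trans hk; rewrite le_eqVlt; apply/orP; left; apply/eqP.
by apply: eq_expect => x _; rewrite distrC.
Qed.

Lemma indic_le1 (A : set X) x : `|\1_A x : R| <= 1.
Proof. by rewrite indicE; case: (_ \in _); rewrite ?normr1 ?normr0. Qed.

Lemma converges_ae_open (U : set X) : open U -> converges_ae (\1_U).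
Proof.
move=> oU; apply: (@converges_ae_limit (plateau U)).
- by move=> k; apply: hcontinuous_measurable => z; exact: plateau_continuous.
- by apply: measurable_indic; exact: borel_open.
- by move=> k x; exact: plateau_le1.
- exact: indic_le1.
- by move=> x; exact: plateau_cvg.
- move=> k.
  by apply: converges_ae_continuous => [z|x]; [exact: plateau_continuous|exact: plateau_le1].
Qed.

Lemma converges_ae_ext f g : (forall x, f x = g x) -> converges_ae f -> converges_ae g.
Proof. by move=> /funext ->. Qed.

Lemma converges_ae_sum (I : Type) (r : seq I) (F : I -> X -> R) :
  (forall i, L1 (F i)) -> (forall i, converges_ae (F i)) ->
  converges_ae (fun x => \sum_(i <- r) F i x).
Proof.
move=> intF gF; elim: r => [|i r IH].
  apply: (@converges_ae_ext (fun x => 0 * 0)); first by move=> x; rewrite big_nil mul0r.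
  apply: (@converges_aeZ _ _ _ _ 0 (cst 0)); first exact: L1_cst.
  apply: converges_ae_continuous => [z e e0|x]; last by rewrite normr0.
  by exists 1 => // y _; rewrite subrr normr0.
apply: (@converges_ae_ext (fun x => F i x + \sum_(j <- r) F j x)).
  by move=> x; rewrite big_cons.
by apply: converges_aeD => //; have [] := Rintegral_sum_integrable mS sS r intF.
Qed.

Lemma converges_ae_indic (A : set (borelH R n)) : measurable A -> converges_ae (\1_A).
Proof.
apply: (@dynkin_induction _ (borelH R n) (@open X) (fun A => converges_ae (\1_A))) => //.
- by move=> U V; exact: openI.
- by apply: converges_ae_open; exact: openT.
- exact: converges_ae_open.
- move=> B mB gB; apply: (@converges_ae_ext (fun x => cst 1 x + -1 * \1_B x)).
    by move=> x; rewrite !indicE in_setC; case: (_ \in _); rewrite /cst/=; ring.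
  apply: converges_aeD; [exact: L1_cst|by apply: L1Z; exact: L1_indic| |].
    apply: (@converges_ae_ext (\1_setT)); first by move=> x; rewrite indicT.
    by apply: converges_ae_open; exact: openT.
  by apply: converges_aeZ => //; exact: L1_indic.
move=> F mF tF gF; pose u k x : R := \sum_(i <- iota 0 k) \1_(F i) x.
(* By disjointness at most one term of the partial sum is nonzero at x, so the sums are bounded by 1
   uniformly in k, as [converges_ae_limit] requires. *)
have uE k i x : F i x -> u k x = (i < k)%:R.
  move=> Fix; rewrite /u (eq_bigr (fun j => (j == i)%:R : R)); last first.
    move=> j _; rewrite indicE; congr ((nat_of_bool _)%:R).
    apply/idP/eqP => [/set_mem Fjx|->]; last exact: mem_set.
    by apply: tF => //; exists x.
  elim: k => [|k IH]; first by rewrite big_nil.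
  rewrite -addn1 iotaD big_cat big_seq1 /= add0n IH.
  rewrite addn1 ltnS (leq_eqVlt i k) (eq_sym i).
  by case: eqVneq => [->|_] /=; rewrite ?ltnn ?add0r ?addr0.
have u0 k x : ~ (\bigcup_i F i) x -> u k x = 0.
  move=> nF; rewrite /u big1// => i _; rewrite indicE memNset// => Fix.
  by apply: nF; exists i.
apply: (@converges_ae_limit u).
- move=> k; apply: measurable_sum => i; exact: measurable_indic.
- by apply: measurable_indic; exact: bigcup_measurable.
- move=> k x; have [[i _ Fix]|nF] := pselect ((\bigcup_i F i) x).
    by rewrite (uE k i)//; case: (_ < _)%N; rewrite ?normr1 ?normr0.
  by rewrite u0// normr0.
- exact: indic_le1.
- move=> x; have [[i _ Fix]|nF] := pselect ((\bigcup_i F i) x).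
    rewrite indicE mem_set; last by exists i.
    apply/cvgrPdist_le => e e0; exists i.+1 => // k /= ik.
    by rewrite (uE k i)// ik subrr normr0 ltW.
  rewrite indicE memNset//= (_ : u ^~ x = cst 0); first exact: cvg_cst.
  by apply: funext => k; rewrite u0.
- by move=> k; apply: converges_ae_sum => i; [exact: L1_indic|exact: gF].
Qed.

Import HBSimple.

Lemma converges_ae_L1 f : L1 f -> converges_ae f.
Proof.
move=> intf; apply: (converges_ae_closed n0 sigma_inv alpha1 intf) => e e0.
have [g_ [intg _ cvg0]] := approximation_sfun_integrable mS intf.
move: cvg0 => /fine_cvgP[_] /cvgrPdist_le/(_ e e0)[k _ /(_ k (leqnn k))] /=.
rewrite sub0r normrN => h; exists (g_ k : borelH R n -> R); split; first exact: intg.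
  apply: converges_ae_ext (fun x => esym (fimfunEord (g_ k) x)) _.
  apply: converges_ae_sum => i; first by apply: L1Z; exact: L1_indic.
  by apply: converges_aeZ; [exact: L1_indic|exact: converges_ae_indic].
apply: le_trans h; exact: ler_norm.
Qed.

End AlmostEverywhere.

(** * Complex values and conclusion *)

Lemma complex_cvg (R : realType) (T : Type) (F : set_system T) {FF : Filter F}
    (f : T -> R[i]) (c : R[i]) :
  (forall e : R, 0 < e -> \forall t \near F, `|complex.Re (f t) - complex.Re c| <= e) ->
  (forall e : R, 0 < e -> \forall t \near F, `|complex.Im (f t) - complex.Im c| <= e) ->
  (f t : R[i]^o) @[t --> F] --> (c : R[i]^o).
Proof.
(* In the order of R[i] a positive number is real, so the tolerance is a real a > 0; a / 2 in each
   component is enough since sqrt(2 (a / 2)^2) <= a. *)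
move=> hRe hIm; apply/cvgrPdist_le => -[a b]; rewrite ltcE /= => /andP[/eqP -> a0].
have a20 : 0 < a / 2 by rewrite divr_gt0.
apply: filterS2 (hRe _ a20) (hIm _ a20) => t {hRe hIm}.
move: (f t) c => [x y] [x' y'] /= hx hy.
rewrite distrC normc_def lecE /= eqxx /=.
apply: ler_of_sqr; first exact: ltW.
rewrite sqr_sqrtr ?addr_ge0 ?sqr_ge0//.
rewrite -[X in X + _ <= _](real_normK (num_real _)) -[X in _ + X <= _](real_normK (num_real _)).
have := normr_ge0 (x - x'); have := normr_ge0 (y - y'); nra.
Qed.

Theorem theorem1p3 (R : realType) (n : nat) (hn : (0 < n)%N)
    (sigma : probability (borelH R n) R)
    (hsigma : rotation_invariant_on_sphere sigma)
    (f : 'cV[quat R]_n -> R[i]) (hf : L1_sphere sigma f)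
    (alpha : R) (halpha : 1 < alpha) :
  {ae sigma, forall zeta : 'cV[quat R]_n, hsphere zeta ->
    (poisson_integral sigma f q : R[i]^o)
      @[q --> within (approach_region alpha zeta) (nbhs zeta)]
      --> (f zeta : R[i]^o)}.
Proof.
case: hf => hRe hIm.
have gRe := converges_ae_L1 hn hsigma halpha hRe.
have gIm := converges_ae_L1 hn hsigma halpha hIm.
apply: negligibleS (negligibleU gRe gIm) => z /= nz.
apply: contrapT => /not_orP[nRe nIm]; apply: nz => Sz.
have cRe : converges_at sigma alpha (fun z => complex.Re (f z)) z.
  by apply: contrapT => ?; apply: nRe.
have cIm : converges_at sigma alpha (fun z => complex.Im (f z)) z.
  by apply: contrapT => ?; apply: nIm.
apply: complex_cvg => e e0.
  have [d d0 h] := cRe e e0; apply/nbhs_hnorm; exists d => // q qd Aq; exact: h.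
have [d d0 h] := cIm e e0; apply/nbhs_hnorm; exists d => // q qd Aq; exact: h.
Qed.
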